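(* Let $Q\subset\mathbb{R}^2$ be a convex polygon and $K\subset\mathbb{R}^2$ a convex shape. If every $Q$-normal triangle fits into $K$, then every closed curve of unit $Q$-length fits into $K$. Consequently, every $Q$-normal triangle fits into $K$ if and only if $c(K\times Q)\ge 1$.
   Context: A convex shape is a compact convex subset of $\mathbb{R}^2$ with non-empty interior. For $x\in\mathbb{R}^2$ let $\|x\|_Q=\max_{y\in Q}\langle x,y\rangle$. The $Q$-length of a closed polygonal curve $v_1\to\dots\to v_m\to v_1$ is $\sum_i \|v_{i+1}-v_i\|_Q$ (indices mod $m$); for rectifiable closed curves it is defined by polygonal approximation. The $Q$-length of closed curves is unchanged if $Q$ is translated, so one may assume $Q$ contains the origin in its interior. A set $A$ fits into $B$ if $A+t\subset B$ for some $t\in\mathbb{R}^2$. A non-degenerate triangle is $Q$-normal if its boundary can be oriented $u\to v\to w\to u$ so that the directions of $v-u$, $w-v$, $u-w$ are outward normal directions of sides of $Q$ and $\|v-u\|_Q+\|w-v\|_Q+\|u-w\|_Q=1$. A segment $[u,v]$ (a degenerate triangle) is $Q$-normal if the directions of $v-u$ and $u-v$ are outward normal directions of sides of $Q$ and $\|v-u\|_Q+\|u-v\|_Q=1$. ''$Q$-normal triangles'' includes both kinds. $c(K\times Q)$ is the Ekeland--Hofer--Zehnder capacity of the lagrangian product $K\times Q\subset\mathbb{R}^2\times\mathbb{R}^2$, i.e. the minimal action of a closed generalized characteristic on $\partial(K\times Q)$; equivalently the minimal $Q$-length of a closed generalized $Q$-Minkowski billiard orbit in $K$. *)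

(* Defs.v *)
From HB Require Import structures.
From mathcomp Require Import all_boot all_order all_algebra.
From mathcomp Require Import all_classical all_reals all_analysis.
Set Implicit Arguments. Unset Strict Implicit. Unset Printing Implicit Defensive.
Import Order.TTheory GRing.Theory Num.Theory.
Import numFieldNormedType.Exports.
Local Open Scope classical_set_scope.
Local Open Scope ring_scope.

Section Defs.
Variable R : realType.
Notation P2 := (R * R)%type.

Definition vadd (x y : P2) : P2 := (x.1 + y.1, x.2 + y.2).
Definition vsub (x y : P2) : P2 := (x.1 - y.1, x.2 - y.2).
Definition vscale (a : R) (x : P2) : P2 := (a * x.1, a * x.2).
Definition dot (x y : P2) : R := x.1 * y.1 + x.2 * y.2.

Definition convex_set (A : set P2) : Prop :=
  forall x y, A x -> A y -> forall t : R, 0 <= t <= 1 ->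
    A (vadd (vscale t x) (vscale (1 - t) y)).

Definition conv_hull (n : nat) (s : 'I_n -> P2) : set P2 :=
  [set x | exists w : 'I_n -> R, (forall i, 0 <= w i) /\ \sum_(i < n) w i = 1 /\
     x = (\sum_(i < n) w i * (s i).1, \sum_(i < n) w i * (s i).2)].

Definition convex_shape (K : set P2) : Prop :=
  compact K /\ convex_set K /\ (interior K !=set0).

Definition convex_polygon (Q : set P2) : Prop :=
  (exists (n : nat) (s : 'I_n -> P2), Q = conv_hull s) /\ (interior Q !=set0).

(* ||x||_Q = max_{y in Q} <x, y> (a max since Q is compact) *)
Definition hQ (Q : set P2) (x : P2) : R := sup [set dot x y | y in Q].

Definition side_normal (Q : set P2) (u : P2) : Prop :=
  u <> (0, 0) /\
  exists y1 y2, Q y1 /\ Q y2 /\ y1 <> y2 /\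
    dot u y1 = hQ Q u /\ dot u y2 = hQ Q u.

Definition seg (u v : P2) : set P2 :=
  [set x | exists t : R, 0 <= t <= 1 /\ x = vadd (vscale t u) (vscale (1 - t) v)].

Definition triangle (u v w : P2) : set P2 :=
  [set x | exists a b c : R, 0 <= a /\ 0 <= b /\ 0 <= c /\ a + b + c = 1 /\
     x = vadd (vscale a u) (vadd (vscale b v) (vscale c w))].

Definition noncollinear (u v w : P2) : Prop :=
  (v.1 - u.1) * (w.2 - u.2) - (v.2 - u.2) * (w.1 - u.1) <> 0.

Definition Qnormal_triangle (Q : set P2) (T : set P2) : Prop :=
  (exists u v w, noncollinear u v w /\ T = triangle u v w /\
     side_normal Q (vsub v u) /\ side_normal Q (vsub w v) /\ side_normal Q (vsub u w) /\
     hQ Q (vsub v u) + hQ Q (vsub w v) + hQ Q (vsub u w) = 1)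
  \/
  (exists u v, T = seg u v /\
     side_normal Q (vsub v u) /\ side_normal Q (vsub u v) /\
     hQ Q (vsub v u) + hQ Q (vsub u v) = 1).

Definition fits (A B : set P2) : Prop :=
  exists t : P2, forall x, A x -> B (vadd x t).

Definition closed_curve (g : R -> P2) : Prop :=
  {within `[0, 1]%classic, continuous g} /\ g 0 = g 1.

Definition curve_image (g : R -> P2) : set P2 := [set g s | s in `[0, 1]%classic].

Definition Qlength (Q : set P2) (g : R -> P2) : \bar R :=
  ereal_sup [set l | exists (n : nat) (t : nat -> R),
     t 0%N = 0 /\ t n = 1 /\ (forall i, (i < n)%N -> t i <= t i.+1) /\
     l = (\sum_(i < n) hQ Q (vsub (g (t i.+1)) (g (t i))))%:E].

Definition abs_cont (a b : R) (f : R -> R) : Prop :=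
  forall e : R, 0 < e -> exists d : R, 0 < d /\
    forall (n : nat) (x y : nat -> R),
      (forall i, (i < n)%N -> a <= x i /\ x i <= y i /\ y i <= b) ->
      (forall i, (i.+1 < n)%N -> y i <= x i.+1) ->
      \sum_(i < n) (y i - x i) < d ->
      \sum_(i < n) `|f (y i) - f (x i)| < e.

Definition normal_cone (A : set P2) (z n : P2) : Prop :=
  forall z', A z' -> dot n (vsub z' z) <= 0.

Definition dvec (g : R -> P2) (t : R) : P2 :=
  (derive1 (fun s => (g s).1) t, derive1 (fun s => (g s).2) t).

Definition derivable2 (g : R -> P2) (t : R) : Prop :=
  derivable (fun s => (g s).1) t 1 /\ derivable (fun s => (g s).2) t 1.

(* closed generalized characteristic z = (q, p) : [0, T] -> boundary of K x Q:
   z absolutely continuous, closed, non-constant, and a.e.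
   (q', p') in J N_{KxQ}(q, p) = { (n_p, - n_q) | n_q in N_K(q), n_p in N_Q(p) } *)
Definition gen_char (K Q : set P2) (T : R) (q p : R -> P2) : Prop :=
  0 < T /\
  abs_cont 0 T (fun s => (q s).1) /\ abs_cont 0 T (fun s => (q s).2) /\
  abs_cont 0 T (fun s => (p s).1) /\ abs_cont 0 T (fun s => (p s).2) /\
  q 0 = q T /\ p 0 = p T /\
  (forall t, 0 <= t <= T ->
     K (q t) /\ Q (p t) /\ (~ interior K (q t) \/ ~ interior Q (p t))) /\
  (exists t, 0 <= t <= T /\ (q t <> q 0 \/ p t <> p 0)) /\
  {ae (@lebesgue_measure R), forall t, 0 <= t <= T ->
     derivable2 q t /\ derivable2 p t /\
     exists nq np, normal_cone K (q t) nq /\ normal_cone Q (p t) np /\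
       dvec q t = np /\ dvec p t = (- nq.1, - nq.2)}.

Definition action (T : R) (q p : R -> P2) : \bar R :=
  (2^-1)%:E * (\int[@lebesgue_measure R]_(t in [set s : R | (0 <= s <= T)%R])
                 (dot (p t) (dvec q t) - dot (q t) (dvec p t))%:E)%E.

(* c(K x Q): minimal action of a closed generalized characteristic on the
   boundary of K x Q (stated as the infimum; the minimum is attained) *)
Definition capacity (K Q : set P2) : \bar R :=
  ereal_inf [set a | exists T q p, gen_char K Q T q p /\ a = action T q p].

End Defs.

(* Main.v *)
Require Import Defs.
From HB Require Import structures.
From mathcomp Require Import all_boot all_order all_algebra.
From mathcomp Require Import all_classical all_reals all_analysis.
From mathcomp Require Import measurable_realfun ring lra.
Set Implicit Arguments. Unset Strict Implicit. Unset Printing Implicit Defensive.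
Import Order.TTheory GRing.Theory Num.Theory.
Import numFieldNormedType.Exports.
Local Open Scope classical_set_scope.
Local Open Scope ring_scope.

(** Every edge of a closed polygon of Q-length L is a nonnegative combination
    of two normals of sides of Q on which the support function of Q is
    additive.  Closed chains of side normals form a cone whose extreme rays are
    supported on at most three normals, that is, are multiples of Q-normal
    triangles; translates of these fit into K, and fitting is stable under
    convex combinations, so the polygon fits into a translate of L K.
    Compactness passes from polygons to curves.

    If a generalized characteristic (q, p) had action A < 1, then q, whose
    Q-length is at most A, would fit into the interior of K by a translation t.
    Then <p', t> >= 0 almost everywhere, with equality only where p' = 0, so the
    closed curve p, and then q, would be constant.

    Conversely let a Q-normal triangle not fit into K.  In R^4 let A be the set
    of triangles with vertices in K modulo translations, and B the set of
    triangles of momenta in Q modulo translations.  A maximizing pair of the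
    pairing over polar(B) x polar(A) yields by bipolarity positions in K and
    momenta in Q which are mutually optimal: a closed billiard trajectory, of
    action less than 1. *)

(** * Support functions and side normals *)

(** Three normals suffice because the plane has dimension two: any three of its vectors satisfy a
    linear relation, and the multiplicities of a chain using a fourth normal can be moved along that
    relation until one of them vanishes. Both the length and the vertices of a chain are linear in
    the multiplicities; this is what the splitting of edges into side normals buys.

    The length of q is at most A because q' is normal to Q at p, so <p, q'> is the support function
    at q'. The derivative is controlled only almost everywhere, hence the work on absolutely
    continuous functions. The slack A < 1 places A K + (1 - A) k0 in the interior of K when k0 is an
    interior point.

    In the converse the pairing is the sum of <p_i, q_(i+1) - q_i>, unchanged by translating all q_i
    or all p_i. A triangle of unit length lies in polar(B), and not fitting puts it outside A. So
    the maximum c of the pairing over the polars exceeds 1, and dividing both maximizers by c leaves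
    the value 1/c < 1. Since the capacity is an infimum, one such trajectory is enough. *)

Lemma dot_continuous (R : realType) (x : R * R) : continuous (dot x).
Proof.
move=> y; rewrite /dot; apply: cvgD; apply: cvgMr; [exact: cvg_fst|exact: cvg_snd].
Qed.

Lemma hQ_ub (R : realType) (A : set (R * R)) x y :
  compact A -> A y -> dot x y <= hQ A x.
Proof.
move=> cA Ay; apply: ub_le_sup; last by exists y.
have [||c _ hc] := @compact_EVT_max _ _ (dot x) A _ cA; first by exists y.
  by apply: continuous_subspaceT; exact: dot_continuous.
by exists (dot x c) => _ [z Az <-]; apply: hc; rewrite inE.
Qed.

Lemma hQ_att (R : realType) (A : set (R * R)) x :
  compact A -> A !=set0 -> exists y, A y /\ hQ A x = dot x y.
Proof.
move=> cA A0.
have [|c cAc hc] := @compact_EVT_max _ _ (dot x) A A0 cA.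
  by apply: continuous_subspaceT; exact: dot_continuous.
rewrite inE in cAc; exists c; split=> //; apply/eqP; rewrite eq_le hQ_ub// andbT.
by apply: ge_sup => [|_ [z Az <-]]; [exists (dot x c), c|apply: hc; rewrite inE].
Qed.

Lemma hQZ (R : realType) (A : set (R * R)) c x : compact A -> A !=set0 ->
  0 <= c -> hQ A (vscale c x) = c * hQ A x.
Proof.
move=> cA A0 c0; apply/eqP; rewrite eq_le; apply/andP; split.
  have [z [Az ->]] := hQ_att (vscale c x) cA A0.
  have -> : dot (vscale c x) z = c * dot x z by rewrite /dot /vscale/=; ring.
  by rewrite ler_wpM2l// hQ_ub.
have [z [Az ->]] := hQ_att x cA A0.
have -> : c * dot x z = dot (vscale c x) z by rewrite /dot /vscale/=; ring.
exact: hQ_ub.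
Qed.

Lemma hQ0 (R : realType) (A : set (R * R)) :
  compact A -> A !=set0 -> hQ A (0, 0) = 0.
Proof.
by move=> cA A0; have [z [_ ->]] := hQ_att (0, 0) cA A0; rewrite /dot/=; ring.
Qed.

Lemma interior_box (R : realType) (A : set (R * R)) y : interior A y ->
  exists r, 0 < r /\ forall u v, `|u| <= r -> `|v| <= r -> A (y.1 + u, y.2 + v).
Proof.
move=> /nbhs_ballP[r /= r0 rA]; exists (r / 2); split; first exact: divr_gt0.
move=> u v ur vr; apply: rA; split; rewrite /ball/= opprD addrA subrr sub0r normrN.
  by apply: le_lt_trans ur _; lra.
by apply: le_lt_trans vr _; lra.
Qed.

Lemma box_interior (R : realType) (A : set (R * R)) (y : R * R) r : 0 < r ->
  (forall u v, `|u| <= r -> `|v| <= r -> A (y.1 + u, y.2 + v)) -> interior A y.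
Proof.
move=> r0 rA; apply/nbhs_ballP; exists r => //= -[z1 z2] [/= h1 h2].
have -> : (z1, z2) = (y.1 + (z1 - y.1), y.2 + (z2 - y.2)) by congr pair; ring.
by apply: rA; rewrite distrC ltW.
Qed.

(** The corner of the box around [y] given by the signs of [x] lies in [A], and its product with [x]
    is the left-hand side. *)
Lemma hQ_interior (R : realType) (A : set (R * R)) y : compact A ->
  interior A y -> exists r, 0 < r /\
    forall x, dot x y + r * (`|x.1| + `|x.2|) <= hQ A x.
Proof.
move=> cA /interior_box[r [r0 h]]; exists r; split=> // x.
have sgr (u : R) : `|r * Num.sg u| <= r.
  rewrite normrM gtr0_norm// normr_sg ger_pMr//.
  by case: (u != 0); rewrite ?lexx ?ler01.
apply: le_trans (hQ_ub x cA (h _ _ (sgr x.1) (sgr x.2))).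
have := numEsg x.1; have := numEsg x.2; rewrite /dot/= => h1 h2.
by rewrite [`|x.1|]normrEsg [`|x.2|]normrEsg; lra.
Qed.

Lemma dot_interior_lt (R : realType) (A : set (R * R)) x y : compact A ->
  interior A y -> x <> (0, 0) -> dot x y < hQ A x.
Proof.
move=> cA /(hQ_interior cA)[r [r0 h]] x0; apply: lt_le_trans (h x).
rewrite ltrDl mulr_gt0// lt_neqAle addr_ge0// andbT eq_sym paddr_eq0//.
rewrite !normr_eq0; apply/negP => /andP[/eqP h1 /eqP h2]; apply: x0.
by case: x h1 h2 {h} => x1 x2 /= -> ->.
Qed.

(** The hull is the image of the simplex of weights, a closed subset of a cube, under a linear
    map. *)
Lemma conv_hull_compact (R : realType) n (s : 'I_n -> R * R) :
  compact (conv_hull s).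
Proof.
pose lin (c : 'I_n -> R) (v : 'rV[R]_n) := \sum_(i < n) v ord0 i * c i.
have lin_cont c : continuous (lin c).
  rewrite /lin; elim: (index_enum _) => [|i r IH].
    by under eq_fun do rewrite big_nil; exact: cst_continuous.
  under eq_fun do rewrite big_cons.
  have ci : continuous (fun v : 'rV[R]_n => v ord0 i * c i).
    move=> v; apply: (@continuousM _ _ (fun v : 'rV[R]_n => v ord0 i) (fun=> c i)).
      exact: coord_continuous.
    exact: cst_continuous.
  by move=> v; exact: (continuousD (ci v) (IH v)).
pose W := [set v : 'rV[R]_n | forall i, `[0, 1]%classic (v ord0 i)] `&`
  (lin (fun=> 1)) @^-1` [set 1].
have cW : compact W.
  apply: compact_closedI; first refine (@rV_compact R n (fun=> `[0, 1]%classic) (fun=> @segment_compact R 0 1)).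
  by have /continuous_closedP := lin_cont (fun=> 1); apply; exact: closed_eq.
have -> : conv_hull s = (fun v => (lin (fst \o s) v, lin (snd \o s) v)) @` W.
  apply/seteqP; split => [x [w [w0 [w1 ->]]]|_ [v [v01 v1] <-]].
    exists (\row_i w i); last first.
      by congr pair; apply: eq_bigr => i _; rewrite mxE.
    split=> /= [i|]; rewrite /lin; last first.
      by rewrite -[RHS]w1; apply: eq_bigr => i _; rewrite mxE mulr1.
    rewrite in_itv/= mxE w0/= -w1 (bigD1 i)//= lerDl.
    by apply: sumr_ge0 => j _.
  exists (fun i => v ord0 i); split=> [i|].
    by have := v01 i; rewrite /= in_itv/= => /andP[].
  split=> //; rewrite -[RHS]v1 /lin.
  by apply: eq_bigr => i _; rewrite mulr1.
apply: continuous_compact => //; apply: continuous_subspaceT => v.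
exact: cvg_pair (lin_cont (fst \o s) v) (lin_cont (snd \o s) v).
Qed.

Lemma conv_hull_convex (R : realType) n (s : 'I_n -> R * R) :
  Defs.convex_set (conv_hull s).
Proof.
move=> x y [w [w0 [w1 ->]]] [w' [w'0 [w'1 ->]]] t /andP[t0 t1].
exists (fun i => t * w i + (1 - t) * w' i); split=> [i|].
  by rewrite addr_ge0// mulr_ge0// subr_ge0.
have E (c : 'I_n -> R) : \sum_(i < n) (t * w i + (1 - t) * w' i) * c i =
    t * (\sum_(i < n) w i * c i) + (1 - t) * (\sum_(i < n) w' i * c i).
  rewrite !mulr_sumr -big_split/=; apply: eq_bigr => i _; ring.
split; last by rewrite /vadd /vscale/= !E.
have := E (fun=> 1); under eq_bigr do rewrite mulr1.
move=> ->; under eq_bigr do rewrite mulr1.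
under [X in _ + _ * X]eq_bigr do rewrite mulr1.
by rewrite w1 w'1; ring.
Qed.

Definition cross (R : realType) (u v : R * R) : R := u.1 * v.2 - u.2 * v.1.

Lemma dot_hull (R : realType) n (s : 'I_n -> R * R) e y :
  (forall i, dot e (s i) <= y) -> forall x, conv_hull s x -> dot e x <= y.
Proof.
move=> es x [w [w0 [w1 ->]]].
have -> : dot e (\sum_(i < n) w i * (s i).1, \sum_(i < n) w i * (s i).2) =
    \sum_(i < n) w i * dot e (s i).
  rewrite /dot/= !mulr_sumr -big_split/=; apply: eq_bigr => i _; ring.
rewrite -[y]mul1r -w1 mulr_suml; apply: ler_sum => i _.
by rewrite ler_wpM2l.
Qed.

Lemma hull_vertex (R : realType) n (s : 'I_n -> R * R) i : conv_hull s (s i).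
Proof.
exists (fun j => (j == i)%:R); split=> [j|]; first by rewrite ler0n.
have E (c : 'I_n -> R) : \sum_(j < n) (j == i)%:R * c j = c i.
  rewrite (bigD1 i)//= eqxx mul1r big1 ?addr0// => j /negPf ->.
  by rewrite mul0r.
split; last by rewrite !E; case: (s i).
by have := E (fun=> 1); under eq_bigr do rewrite mulr1.
Qed.

Lemma hQ_hull (R : realType) n (s : 'I_n -> R * R) e j :
  (forall i, dot e (s i) <= dot e (s j)) -> hQ (conv_hull s) e = dot e (s j).
Proof.
move=> h; have cQ := @conv_hull_compact R n s; have Qj := hull_vertex s j.
apply/eqP; rewrite eq_le hQ_ub// andbT.
have [|y [Qy ->]] := hQ_att e cQ; first by exists (s j).
exact: dot_hull Qy.
Qed.

Section side_normals.
Variables (R : realType) (n : nat) (s : 'I_n -> R * R).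
Let Q := conv_hull s.
Hypothesis Q0 : interior Q !=set0.

(** A nonzero [v] constant on the vertices would make the support function at [v] and at [-v] add up
    to zero, whereas at an interior point both bounds are strict. *)
Lemma hull_not_flat (j : 'I_n) (v : R * R) :
  (forall i, dot v (s i) = dot v (s j)) -> v = (0, 0).
Proof.
move=> h; apply: contrapT => v0; have [y Qy] := Q0.
have cQ := @conv_hull_compact R n s.
have nv0 : vscale (-1) v <> (0, 0).
  by case: v v0 {h} => v1 v2 v0 /= [h1 h2]; apply: v0; congr pair; lra.
have N z : dot (vscale (-1) v) z = - dot v z by rewrite /dot /vscale/=; ring.
have := dot_interior_lt cQ Qy v0; have := dot_interior_lt cQ Qy nv0.
rewrite (@hQ_hull _ _ _ v j) => [|i]; last by rewrite h.
rewrite (@hQ_hull _ _ _ (vscale (-1) v) j) => [|i]; last by rewrite !N h.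
by rewrite !N; lra.
Qed.

Variables (a : R * R) (o : 'I_n).
Hypotheses (a0 : a <> (0, 0)) (ao : forall i, dot a (s i) <= dot a (s o)).
Let d i := vsub (s i) (s o).

(* Moving [a] in the direction [w] until it leaves the normal cone of the
   vertex [s o] produces a normal of a side at [s o]. *)
Lemma side_normal_exit w j k : 0 < dot w (d j) -> dot w (d k) < 0 ->
  exists t, 0 <= t /\ side_normal Q (vadd a (vscale t w)) /\
    hQ Q (vadd a (vscale t w)) = dot (vadd a (vscale t w)) (s o).
Proof.
move=> wj wk.
have ad i : dot a (d i) <= 0.
  by have := ao i; rewrite /dot /d /vsub/=; lra.
have eE t i : dot (vadd a (vscale t w)) (d i) = dot a (d i) + t * dot w (d i).
  by rewrite /dot /vadd /vscale/=; ring.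
have dE e i : dot e (s i) = dot e (s o) + dot e (d i).
  by rewrite /dot /d /vsub/=; ring.
(* Ratio test: [t] is the first time at which another vertex, [s i1], ties with [s o]. *)
case: (@Order.TotalTheory.arg_minP _ _ _ j (fun i => 0 < dot w (d i))
  (fun i => - dot a (d i) / dot w (d i)) wj) => i1 wi1 hmin.
set t := - dot a (d i1) / dot w (d i1) in hmin.
have t0 : 0 <= t by rewrite divr_ge0 ?oppr_ge0// ltW.
have tight : dot (vadd a (vscale t w)) (d i1) = 0.
  by rewrite eE /t; field; rewrite gt_eqF.
have le i : dot (vadd a (vscale t w)) (d i) <= 0.
  rewrite eE; have [wi|wi] := ltP 0 (dot w (d i)).
    by have := hmin i wi; rewrite ler_pdivlMr//; lra.
  by have := ad i; have := mulr_ge0_le0 t0 wi; lra.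
have hE : hQ Q (vadd a (vscale t w)) = dot (vadd a (vscale t w)) (s o).
  by apply: hQ_hull => i; rewrite (dE _ i) gerDl.
exists t; split=> //; split=> //; split.
  (* The index [k] keeps the exit vector nonzero: its value at [d k] is a sum of two nonpositive
     terms, so vanishing would force [t = 0] and then [a = 0]. *)
  move=> e0; have := eE t k; rewrite e0 /dot/= !mul0r addr0.
  have := ad k; rewrite -/(dot a (d k)) -/(dot w (d k)) => ak h.
  have tk : t * dot w (d k) <= 0 by rewrite mulr_ge0_le0// ltW.
  have /eqP : t * dot w (d k) = 0 by lra.
  rewrite mulf_eq0 (lt_eqF wk) orbF => /eqP t00; apply: a0.
  by move: e0; rewrite t00 /vadd /vscale !mul0r !addr0; case: (a).
exists (s o), (s i1); split; first exact: hull_vertex.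
split; first exact: hull_vertex.
split; last by rewrite hE (dE _ i1) tight addr0.
by move=> e; move: wi1; rewrite /d -e /vsub /dot/= !subrr !mulr0 addr0 ltxx.
Qed.

(** The line through [a] in the direction [w] leaves the normal cone of [s o] on both sides, and [a]
    is a convex combination of the two exits. On this cone the support function is the linear form
    given by [s o], hence additive. *)
Lemma side_decomp_vertex : exists e1 e2 c1 c2,
  [/\ side_normal Q e1, side_normal Q e2, 0 <= c1, 0 <= c2 &
    a = vadd (vscale c1 e1) (vscale c2 e2) /\
    hQ Q a = c1 * hQ Q e1 + c2 * hQ Q e2].
Proof.
have [j [k jk]] : exists j k, cross (d j) (d k) != 0.
  apply: contrapT => h.
  have {}h j k : cross (d j) (d k) = 0.
    by apply/eqP/negPn/negP => jk; apply: h; exists j, k.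
  have flat v : (forall i, dot v (d i) = 0) -> v = (0, 0).
    move=> vd; apply: (@hull_not_flat o) => i.
    by have := vd i; rewrite /dot /d /vsub/=; lra.
  have d0 j : d j = (0, 0).
    have /flat : forall i, dot (- (d j).2, (d j).1) (d i) = 0.
      by move=> i; have := h j i; rewrite /cross /dot/=; lra.
    by case: (d j) => x y /= [/eqP]; rewrite oppr_eq0 => /eqP -> ->.
  have /flat[/eqP] : forall i, dot (1, 0) (d i) = 0.
    by move=> i; rewrite d0 /dot/=; ring.
  by rewrite oner_eq0.
have [w [j' [k' [wj wk]]]] : exists w j' k', 0 < dot w (d j') /\ dot w (d k') < 0.
  (* A quarter turn of [d j + d k]: it takes opposite nonzero values on [d j] and [d k]. *)
  pose w := (- ((d j).2 + (d k).2), (d j).1 + (d k).1).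
  have wj : dot w (d j) = - cross (d j) (d k) by rewrite /dot /cross /w/=; ring.
  have wk : dot w (d k) = cross (d j) (d k) by rewrite /dot /cross /w/=; ring.
  case: (ltgtP (cross (d j) (d k)) 0) jk => // c0 _.
    by exists w, j, k; rewrite wj wk; lra.
  by exists w, k, j; rewrite wj wk; lra.
have N z : dot (vscale (-1) w) z = - dot w z by rewrite /dot /vscale/=; ring.
have [t1 [t10 [n1 h1]]] := side_normal_exit wj wk.
have [||t2 [t20 [n2 h2]]] := @side_normal_exit (vscale (-1) w) k' j'.
- by rewrite N; lra.
- by rewrite N; lra.
have ha : hQ Q a = dot a (s o) by exact: hQ_hull.
(* If both exits occur at time zero, [a] is itself a side normal. *)
have [t0|t0] := eqVneq (t1 + t2) 0.
  have t1_0 : t1 = 0 by lra.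
  have E : vadd a (vscale t1 w) = a.
    by rewrite t1_0 /vadd /vscale !mul0r !addr0; case: (a).
  rewrite E in n1; exists a, a, 1, 0; split=> //; split; last by ring.
  by rewrite /vadd /vscale; case: (a) => x y /=; congr pair; ring.
exists (vadd a (vscale t1 w)), (vadd a (vscale t2 (vscale (-1) w))),
  (t2 / (t1 + t2)), (t1 / (t1 + t2)).
split=> //; [by rewrite divr_ge0// addr_ge0|by rewrite divr_ge0// addr_ge0|].
rewrite h1 h2 ha; split; last by rewrite /dot /vadd /vscale/=; field.
by rewrite /vadd /vscale; case: (a) => x y /=; congr pair; field.
Qed.
End side_normals.

Lemma side_decomp (R : realType) n (s : 'I_n -> R * R) (a : R * R)
    (Q := conv_hull s) : interior Q !=set0 ->
  exists e1 e2 c1 c2,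
    [/\ side_normal Q e1, side_normal Q e2, 0 <= c1, 0 <= c2 &
      a = vadd (vscale c1 e1) (vscale c2 e2) /\
      hQ Q a = c1 * hQ Q e1 + c2 * hQ Q e2].
Proof.
move=> Q0.
have cQ : compact Q by exact: conv_hull_compact.
have [i0] : exists i0 : 'I_n, True.
  have [y /interior_subset[w [_ [w1 _]]]] := Q0.
  case: n s @Q Q0 cQ w w1 => [|m] s' Q' Q'0 cQ' w w1;
    last by exists ord0.
  by move: w1; rewrite big_ord0 => /eqP; rewrite eq_sym oner_eq0.
have base a' : a' <> (0, 0) -> exists e1 e2 c1 c2,
    [/\ side_normal Q e1, side_normal Q e2, 0 <= c1, 0 <= c2 &
      a' = vadd (vscale c1 e1) (vscale c2 e2) /\
      hQ Q a' = c1 * hQ Q e1 + c2 * hQ Q e2].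
  move=> a0; case: (@Order.TotalTheory.arg_maxP _ _ _ i0 xpredT
    (fun i => dot a' (s i)) isT) => o _ ho.
  by apply: (@side_decomp_vertex _ _ _ Q0 a' o) => // i; exact: ho.
(* The zero vector gets zero coefficients, but some side normal must still be exhibited; decomposing
   [(1, 0)] supplies one. *)
move=> _; have [->|/base//] := pselect (a = (0, 0)).
have [|e [_ [_ [_ [ne _ _ _ _]]]]] := base (1, 0).
  by move=> [/eqP]; rewrite oner_eq0.
exists e, e, 0, 0; split=> //; split.
  by rewrite /vadd /vscale !mul0r addr0.
rewrite hQ0//; first by ring.
by have [y /interior_subset] := Q0; exists y.
Qed.

(** * Fitting closed polygons and curves *)

Section circuits.
Variables (R : realType) (Q K : set (R * R)) (y0 : R * R).
Hypotheses (cQ : compact Q) (Qy0 : interior Q y0).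
Hypotheses (cvK : Defs.convex_set K) (K0 : K !=set0).
Hypothesis QK : forall T, Qnormal_triangle Q T -> fits T K.
Variables (N : nat) (e : 'I_N -> R * R).
Hypothesis ne : forall k, side_normal Q (e k).
Implicit Types c l : 'I_N -> R.

Let Q0 : Q !=set0.
Proof. by exists y0; exact: interior_subset. Qed.

Definition closed_chain c := (forall k, 0 <= c k) /\
  \sum_k c k * (e k).1 = 0 /\ \sum_k c k * (e k).2 = 0.

Definition chain_len c := \sum_k c k * hQ Q (e k).

(** The vertex reached after the edges of index below [m]. The indicator keeps the index set fixed,
    so that the vertex is visibly linear in [c]. *)
Definition chain_pt c (m : nat) : R * R :=
  (\sum_(k < N) c k * ((k < m)%N%:R * (e k).1),
   \sum_(k < N) c k * ((k < m)%N%:R * (e k).2)).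

(** Scaling [K] instead of dividing by the length includes chains of length zero and makes the
    condition stable under nonnegative combinations. *)
Definition chain_fits c := exists t, forall m, exists z,
  K z /\ vadd (chain_pt c m) t = vscale (chain_len c) z.

(** For a closed chain the products of its edges with [y0] sum to zero; subtracting them from the
    length leaves terms [c j * (hQ Q (e j) - dot (e j) y0)] whose second factor is positive, [y0]
    being interior. *)
Lemma chain_len_gt0 c k : closed_chain c -> c k != 0 -> 0 < chain_len c.
Proof.
move=> [c0 [s1 s2]] ck.
have -> : chain_len c = \sum_j c j * (hQ Q (e j) - dot (e j) y0).
  have : \sum_j c j * dot (e j) y0 = 0.
    transitivity ((\sum_j c j * (e j).1) * y0.1 + (\sum_j c j * (e j).2) * y0.2).
      rewrite !mulr_suml -big_split/=; apply: eq_bigr => j _; rewrite /dot; ring.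
    by rewrite s1 s2; ring.
  rewrite /chain_len => h; rewrite -[LHS]subr0 -{2}h -sumrB.
  by apply: eq_bigr => j _; rewrite mulrBr.
have pos j : 0 < hQ Q (e j) - dot (e j) y0.
  by rewrite subr_gt0 dot_interior_lt//; have [] := ne j.
rewrite (bigD1 k)//= ltr_wpDr//.
  by apply: sumr_ge0 => j _; rewrite mulr_ge0// ltW.
by rewrite mulr_gt0// lt_neqAle eq_sym ck c0.
Qed.

Lemma chain_len_ge0 c : closed_chain c -> 0 <= chain_len c.
Proof.
move=> cc; have [[k ck]|h] := pselect (exists k, c k != 0).
  exact/ltW/chain_len_gt0/ck.
rewrite /chain_len big1// => k _; suff -> : c k = 0 by rewrite mul0r.
by apply: contrapT => /eqP ck; apply: h; exists k.
Qed.

Lemma chain_lin a1 a2 c1 c2 (F : 'I_N -> R) :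
  \sum_k (a1 * c1 k + a2 * c2 k) * F k =
  a1 * (\sum_k c1 k * F k) + a2 * (\sum_k c2 k * F k).
Proof.
rewrite !mulr_sumr -big_split/=; apply: eq_bigr => k _; ring.
Qed.

(** Convexity of [K] in the form r K + s K = (r + s) K, applied to [r = a1 * chain_len c1] and
    [s = a2 * chain_len c2]; the translations combine in the same way as the chains. *)
Lemma chain_fits_comb a1 a2 c1 c2 : 0 <= a1 -> 0 <= a2 ->
  closed_chain c1 -> closed_chain c2 -> chain_fits c1 -> chain_fits c2 ->
  chain_fits (fun k => a1 * c1 k + a2 * c2 k).
Proof.
move=> a10 a20 cc1 cc2 [t1 h1] [t2 h2].
have l1 := chain_len_ge0 cc1; have l2 := chain_len_ge0 cc2.
exists (vadd (vscale a1 t1) (vscale a2 t2)) => m.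
have [z1 [Kz1]] := h1 m; have [z2 [Kz2]] := h2 m.
rewrite /chain_pt /vadd /vscale/= => -[e21 e22] [e11 e12].
rewrite !chain_lin /chain_len chain_lin -/(chain_len c1) -/(chain_len c2).
set s := a1 * chain_len c1 + a2 * chain_len c2.
have [s0|s0] := eqVneq s 0.
  have /andP[/eqP E1 /eqP E2] : (a1 * chain_len c1 == 0) && (a2 * chain_len c2 == 0).
    by rewrite -paddr_eq0 ?mulr_ge0//; exact/eqP.
  exists z1; split=> //; rewrite s0; congr pair.
    transitivity (a1 * chain_len c1 * z1.1 + a2 * chain_len c2 * z2.1).
      by rewrite -!mulrA -e11 -e21; ring.
    by rewrite E1 E2; ring.
  transitivity (a1 * chain_len c1 * z1.2 + a2 * chain_len c2 * z2.2).
    by rewrite -!mulrA -e12 -e22; ring.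
  by rewrite E1 E2; ring.
have sp : 0 < s by rewrite lt_neqAle eq_sym s0 addr_ge0// mulr_ge0.
pose r := a1 * chain_len c1 / s.
have r01 : 0 <= r <= 1.
  rewrite divr_ge0 ?mulr_ge0 ?(ltW sp)//= ler_pdivrMr// mul1r /s lerDl.
  exact: mulr_ge0.
exists (vadd (vscale r z1) (vscale (1 - r) z2)); split; first exact: cvK.
have r1 : s * r = a1 * chain_len c1 by rewrite /r mulrC divfK.
have r2 : s * (1 - r) = a2 * chain_len c2 by rewrite mulrBr r1 /s; ring.
have rE u v : s * (r * u + (1 - r) * v) =
    a1 * (chain_len c1 * u) + a2 * (chain_len c2 * v).
  by rewrite mulrDr (mulrA s r) (mulrA s (1 - r)) r1 r2 !mulrA.
rewrite /vadd /vscale/=; congr pair; rewrite rE.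
  by rewrite -e11 -e21; ring.
by rewrite -e12 -e22; ring.
Qed.

Definition chain_supp c := [set k | c k != 0%R]%SET.

(* Subtracting the largest possible multiple of a linear dependency. *)
Lemma chain_peel c l i : closed_chain c ->
  \sum_k l k * (e k).1 = 0 -> \sum_k l k * (e k).2 = 0 ->
  (forall k, l k != 0 -> c k != 0) -> 0 < l i ->
  exists a, [/\ 0 < a, closed_chain (fun k => 1 * c k + (- a) * l k) &
    (#|chain_supp (fun k => 1 * c k + (- a) * l k)%R| < #|chain_supp c|)%N].
Proof.
move=> [c0 [s1 s2]] l1 l2 lc li.
case: (@Order.TotalTheory.arg_minP _ _ _ i (fun k => 0 < l k)
  (fun k => c k / l k) li) => i1 li1 hmin.
have ci1 : c i1 != 0 by rewrite lc// gt_eqF.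
have a0 : 0 < c i1 / l i1 by rewrite divr_gt0// lt_neqAle eq_sym ci1 c0.
exists (c i1 / l i1); split=> //.
  split=> [k|]; last by rewrite !chain_lin s1 s2 l1 l2; split; ring.
  have [lk|lk] := ltP 0 (l k).
    by have := hmin k lk; rewrite ler_pdivlMr//; lra.
  by have := c0 k; have := mulr_ge0_le0 (ltW a0) lk; lra.
apply: proper_card; apply/properP; split.
  apply/fintype.subsetP => k; rewrite !inE; apply: contraNneq => ck.
  have [->|/lc] := eqVneq (l k) 0; first by rewrite ck; apply/eqP; ring.
  by rewrite ck eqxx.
exists i1; rewrite inE// negbK; apply/eqP; field.
by rewrite gt_eqF.
Qed.

(** If [l] takes both signs, moving [c] along [l] and along [-l] gives two chains of smaller support
    with [c] between them. If [l] is nonnegative, it is itself a closed chain, of smaller support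
    because it misses [m], and [c] is a peeled chain plus a multiple of [l]. *)
Lemma chain_reduce c l i m : closed_chain c ->
  \sum_k l k * (e k).1 = 0 -> \sum_k l k * (e k).2 = 0 ->
  (forall k, l k != 0 -> c k != 0) -> l i != 0 -> l m = 0 -> c m != 0 ->
  (forall c', closed_chain c' -> (#|chain_supp c'| < #|chain_supp c|)%N ->
    chain_fits c') -> chain_fits c.
Proof.
wlog li : l / 0 < l i.
  move=> wl cc l1 l2 lc li lm cm IH; have [lp|] := ltP 0 (l i).
    exact: (wl l).
  rewrite le_eqVlt (negbTE li)/= => lneg.
  apply: (wl (fun k => - l k)) => //.
  - by rewrite oppr_gt0.
  - by under eq_bigr do rewrite mulNr; rewrite sumrN l1 oppr0.
  - by under eq_bigr do rewrite mulNr; rewrite sumrN l2 oppr0.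
  - by move=> k; rewrite oppr_eq0; exact: lc.
  - by rewrite oppr_eq0.
  - by rewrite lm oppr0.
move=> cc l1 l2 lc _ lm cm IH.
have [a [a0 cc1 sc1]] := chain_peel cc l1 l2 lc li.
have [[j lj]|lpos] := pselect (exists j, l j < 0).
  have [||k||b [b0 cc2 sc2]] := @chain_peel c (fun k => - l k) j cc.
  - by under eq_bigr do rewrite mulNr; rewrite sumrN l1 oppr0.
  - by under eq_bigr do rewrite mulNr; rewrite sumrN l2 oppr0.
  - by rewrite oppr_eq0; exact: lc.
  - by rewrite oppr_gt0.
  have ab : 0 < a + b by rewrite addr_gt0.
  have := @chain_fits_comb (b / (a + b)) (a / (a + b)) _ _ _ _ cc1 cc2
    (IH _ cc1 sc1) (IH _ cc2 sc2).
  rewrite !divr_ge0 ?(ltW ab) ?(ltW a0) ?(ltW b0)// => /(_ isT isT).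
  congr chain_fits; apply/funext => k; field; exact: lt0r_neq0.
have ccl : closed_chain l.
  by split=> // k; rewrite leNgt; apply/negP => lk; apply: lpos; exists k.
have scl : (#|chain_supp l| < #|chain_supp c|)%N.
  apply: proper_card; apply/properP; split.
    by apply/fintype.subsetP => k; rewrite !inE; exact: lc.
  by exists m; rewrite inE// lm eqxx.
have := @chain_fits_comb 1 a _ _ _ _ cc1 ccl (IH _ cc1 sc1) (IH _ ccl scl).
rewrite ler01 (ltW a0) => /(_ isT isT).
by congr chain_fits; apply/funext => k; ring.
Qed.

Lemma chain_fits_normal c T : 0 < chain_len c -> Qnormal_triangle Q T ->
  (forall m, T (vscale (chain_len c)^-1 (chain_pt c m))) -> chain_fits c.
Proof.
move=> h0 /QK[t tK] hT; exists (vscale (chain_len c) t) => m.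
exists (vadd (vscale (chain_len c)^-1 (chain_pt c m)) t); split; first exact: tK.
by rewrite /vadd /vscale/=; congr pair; field; rewrite gt_eqF.
Qed.

Lemma side_normalZ u r : 0 < r -> side_normal Q u -> side_normal Q (vscale r u).
Proof.
move=> r0 [u0 [z1 [z2 [Q1 [Q2 [z12 [h1 h2]]]]]]]; split.
  move=> E; apply: u0; case: (u) E => u1 u2 [/eqP].
  rewrite mulf_eq0 (gt_eqF r0)/= => /eqP -> /eqP.
  by rewrite mulf_eq0 (gt_eqF r0)/= => /eqP ->.
exists z1, z2; rewrite hQZ ?(ltW r0)// -h1.
have E z : dot (vscale r u) z = r * dot u z by rewrite /dot /vscale/=; ring.
by rewrite !E h2 h1.
Qed.

Lemma sum_supp c (F : 'I_N -> R) :
  \sum_k c k * F k = \sum_(k <- enum (chain_supp c)) c k * F k.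
Proof.
rewrite big_enum/= (bigID (mem (chain_supp c)))/= [X in _ + X]big1 ?addr0//.
by move=> k; rewrite !inE negbK => /eqP ->; rewrite mul0r.
Qed.

(** The order is what identifies the points [chain_pt c m] of a chain with two or three edges as the
    vertices of a segment or a triangle. *)
Lemma sorted_supp c :
  sorted (fun i j : 'I_N => (i < j)%N) (enum (chain_supp c)).
Proof.
rewrite {1}/(enum _) -enumT; apply: sorted_filter.
  by move=> x y z; exact: ltn_trans.
have := iota_ltn_sorted 0 N; rewrite -val_enum_ord sorted_map.
by [].
Qed.

Lemma chain_delta (x1 x2 x3 : R) (i j k : 'I_N) (F : 'I_N -> R) :
  \sum_h (x1 * (h == i)%:R + x2 * (h == j)%:R + x3 * (h == k)%:R) * F h =
  x1 * F i + x2 * F j + x3 * F k.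
Proof.
have E x (o : 'I_N) : \sum_h x * (h == o)%:R * F h = x * F o.
  rewrite (bigD1 o)//= eqxx mulr1 big1 ?addr0// => h /negPf ->.
  by rewrite mulr0 mul0r.
by rewrite -!E -!big_split/=; apply: eq_bigr => h _; rewrite !mulrDl.
Qed.

(** Induction on the size of the support. Four or more edges, or three edges of which the first two
    are parallel, admit a relation that omits an edge and are reduced. A single edge cannot close
    up; two edges form a multiple of a normal segment, three a multiple of a normal triangle. *)
Lemma chain_fits_all c : closed_chain c -> chain_fits c.
Proof.
have [n] := ubnP #|chain_supp c|; elim: n c => // n IHn c scn cc.
have IH c' : closed_chain c' -> (#|chain_supp c'| < #|chain_supp c|)%N ->
    chain_fits c'.
  by move=> cc' sc'; apply: IHn => //; apply: leq_trans sc' _; rewrite -ltnS.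
have inS k : (k \in enum (chain_supp c)) = (c k != 0) by rewrite mem_enum inE.
have cp k : c k != 0 -> 0 < c k.
  by move=> ck; rewrite lt_neqAle eq_sym ck; have [->] := cc.
have e0 k : 0 < (e k).1 ^+ 2 + (e k).2 ^+ 2.
  rewrite lt_neqAle addr_ge0 ?sqr_ge0// andbT eq_sym paddr_eq0 ?sqr_ge0//.
  rewrite !sqrf_eq0; apply/negP => /andP[/eqP h1 /eqP h2].
  by have [+ _] := ne k; apply; case: (e k) h1 h2 => x y /= -> ->.
have [_ [s1 s2]] := cc; have lenE := sum_supp c (fun k => hQ Q (e k)).
rewrite -/(chain_len c) in lenE.
have ptE m : chain_pt c m =
    (\sum_(k <- enum (chain_supp c)) c k * ((k < m)%N%:R * (e k).1),
     \sum_(k <- enum (chain_supp c)) c k * ((k < m)%N%:R * (e k).2)).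
  by rewrite /chain_pt -!sum_supp.
have so := sorted_supp c.
have un := enum_uniq (chain_supp c).
move: s1 s2; rewrite !sum_supp => s1 s2.
have par i j m : c i != 0 -> c j != 0 -> c m != 0 -> i != j -> i != m ->
    j != m -> cross (e i) (e j) = 0 -> chain_fits c.
  move=> ci cj cm ij im jm eij.
  (* For parallel vectors, <e_j, e_j> e_i = <e_i, e_j> e_j. *)
  pose x1 := (e j).1 ^+ 2 + (e j).2 ^+ 2; pose x2 := - dot (e i) (e j).
  apply: (@chain_reduce c (fun h => x1 * (h == i)%:R + x2 * (h == j)%:R + 0 * (h == j)%:R) i m) => //.
  - rewrite chain_delta mul0r addr0.
    have -> : x1 * (e i).1 + x2 * (e j).1 = (e j).2 * cross (e i) (e j).
      by rewrite /x1 /x2 /cross /dot; ring.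
    by rewrite eij mulr0.
  - rewrite chain_delta mul0r addr0.
    have -> : x1 * (e i).2 + x2 * (e j).2 = - (e j).1 * cross (e i) (e j).
      by rewrite /x1 /x2 /cross /dot; ring.
    by rewrite eij mulr0.
  - move=> k; have [->//|ki] := eqVneq k i; have [->//|kj] := eqVneq k j.
    by rewrite !mulr0 !addr0 eqxx.
  - rewrite eqxx (negbTE ij) !mulr0 !addr0 mulr1; exact: lt0r_neq0 (e0 j).
  - by rewrite (eq_sym m i) (negbTE im) (eq_sym m j) (negbTE jm) !mulr0 !addr0.
case E : (enum (chain_supp c)) => [|i [|j [|k [|m r]]]].
- exists (0, 0) => m; have [z Kz] := K0; exists z; split=> //.
  rewrite ptE lenE E !big_nil /vadd /vscale/=; congr pair; ring.
- have ci : c i != 0 by rewrite -inS E !inE eqxx.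
  move: s1 s2; rewrite E !big_seq1 => /eqP; rewrite mulf_eq0 (negbTE ci)/= => /eqP s1.
  move=> /eqP; rewrite mulf_eq0 (negbTE ci)/= => /eqP s2.
  by have := e0 i; rewrite s1 s2 !expr0n/= addr0 ltxx.
- have ci : c i != 0 by rewrite -inS E !inE eqxx.
  have cj : c j != 0 by rewrite -inS E !inE eqxx orbT.
  have hc := chain_len_gt0 cc ci.
  move: so s1 s2; rewrite E/= !big_cons !big_nil => /andP[ij _] s1 s2.
  set h := chain_len c in hc lenE *.
  pose v := vscale (c i / h) (e i).
  have E1 : vsub v (0, 0) = vscale (c i / h) (e i).
    by rewrite /vsub /v/= !subr0.
  have E2 : vsub (0, 0) v = vscale (c j / h) (e j).
    rewrite /vsub /v /vscale/= !sub0r -!mulNr; congr pair.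
      have -> : c j / h * (e j).1 = (c j * (e j).1) / h by field; rewrite gt_eqF.
      have -> : c j * (e j).1 = - (c i * (e i).1) by lra.
      by field; rewrite gt_eqF.
    have -> : c j / h * (e j).2 = (c j * (e j).2) / h by field; rewrite gt_eqF.
    have -> : c j * (e j).2 = - (c i * (e i).2) by lra.
    by field; rewrite gt_eqF.
  apply: (@chain_fits_normal c (seg (0, 0) v)) => //.
    right; exists (0, 0), v; rewrite E1 E2; split=> //.
    split; first by apply: side_normalZ => //; rewrite divr_gt0// cp.
    split; first by apply: side_normalZ => //; rewrite divr_gt0// cp.
    rewrite !hQZ ?divr_ge0 ?(ltW hc) ?(ltW (cp _ _))//.
    have : h = c i * hQ Q (e i) + c j * hQ Q (e j).
      by rewrite lenE E !big_cons big_nil addr0.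
    move=> hE; apply: (@mulfI _ h); first by rewrite gt_eqF.
    by rewrite mulr1 [RHS]hE; field; rewrite gt_eqF.
  move=> m; rewrite ptE E !big_cons !big_nil !addr0 /seg /= -/h.
  have [jm|mj] := ltnP j m.
    have im := ltn_trans ij jm; exists 1; split; first by rewrite ler01 lexx.
    rewrite addr0 in s1; rewrite addr0 in s2.
    by rewrite im !mul1r s1 s2 /vadd /vscale/=; congr pair; ring.
  have [im|mi] := ltnP i m.
    exists 0; split; first by rewrite ler01 lexx.
    by rewrite /v /vadd /vscale/=; congr pair; field; rewrite gt_eqF.
  exists 1; split; first by rewrite ler01 lexx.
  by rewrite /v /vadd /vscale/=; congr pair; ring.
- have ci : c i != 0 by rewrite -inS E !inE eqxx.
  have cj : c j != 0 by rewrite -inS E !inE eqxx orbT.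
  have ck : c k != 0 by rewrite -inS E !inE eqxx !orbT.
  have hc := chain_len_gt0 cc ci.
  have [eij|eij] := eqVneq (cross (e i) (e j)) 0.
    move: un; rewrite E /= !inE negb_or => /and3P[/andP[ij ik] jk _].
    exact: (par i j k).
  move: so s1 s2; rewrite E/= !big_cons !big_nil !addr0 => /and3P[ij jk _] s1 s2.
  set h := chain_len c in hc lenE *.
  have h0 : h != 0 by rewrite gt_eqF.
  pose v := vscale (c i / h) (e i).
  pose w := vadd v (vscale (c j / h) (e j)).
  have E1 : vsub v (0, 0) = vscale (c i / h) (e i).
    by rewrite /vsub /v/= !subr0.
  have E2 : vsub w v = vscale (c j / h) (e j).
    by rewrite /vsub /w /v /vscale/=; congr pair; ring.
  have E3 : vsub (0, 0) w = vscale (c k / h) (e k).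
    rewrite /vsub /w /v /vscale/= !sub0r; congr pair.
      have -> : c k / h * (e k).1 = (c k * (e k).1) / h by field.
      have -> : c k * (e k).1 = - (c i * (e i).1) - c j * (e j).1 by lra.
      by field.
    have -> : c k / h * (e k).2 = (c k * (e k).2) / h by field.
    have -> : c k * (e k).2 = - (c i * (e i).2) - c j * (e j).2 by lra.
    by field.
  apply: (@chain_fits_normal c (triangle (0, 0) v w)) => //.
    left; exists (0, 0), v, w; rewrite E1 E2 E3; split.
      rewrite /noncollinear /= !subr0.
      have -> : c i / h * (e i).1 * (c i / h * (e i).2 + c j / h * (e j).2) -
        c i / h * (e i).2 * (c i / h * (e i).1 + c j / h * (e j).1) =
        (c i / h) * (c j / h) * cross (e i) (e j) by rewrite /cross; ring.
      by apply/eqP; rewrite !mulf_neq0// invr_eq0.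
    split=> //.
    split; first by apply: side_normalZ => //; rewrite divr_gt0// cp.
    split; first by apply: side_normalZ => //; rewrite divr_gt0// cp.
    split; first by apply: side_normalZ => //; rewrite divr_gt0// cp.
    rewrite !hQZ ?divr_ge0 ?(ltW hc) ?(ltW (cp _ _))//.
    have hE : h = c i * hQ Q (e i) + c j * hQ Q (e j) + c k * hQ Q (e k).
      by rewrite lenE E !big_cons big_nil addr0 addrA.
    apply: (mulfI h0); rewrite mulr1 [RHS]hE; field => //.
  move=> m; rewrite ptE E !big_cons !big_nil !addr0 /triangle /= -/h.
  have [km|mk] := ltnP k m.
    have jm := ltn_trans jk km; have im := ltn_trans ij jm.
    exists 1, 0, 0; rewrite ler01 lexx; do 3!split=> //.
    split; first by ring.
    rewrite im jm !mul1r s1 s2 /vadd /vscale/=; congr pair; ring.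
  have [jm|mj] := ltnP j m.
    have im := ltn_trans ij jm.
    exists 0, 0, 1; rewrite ler01 lexx; do 3!split=> //.
    split; first by ring.
    by rewrite im /w /v /vadd /vscale/=; congr pair; field.
  have [im|mi] := ltnP i m.
    exists 0, 1, 0; rewrite ler01 lexx; do 3!split=> //.
    split; first by ring.
    by rewrite /w /v /vadd /vscale/=; congr pair; field.
  exists 1, 0, 0; rewrite ler01 lexx; do 3!split=> //.
  split; first by ring.
  by rewrite /vadd /vscale/=; congr pair; ring.
- have ci : c i != 0 by rewrite -inS E !inE eqxx.
  have cj : c j != 0 by rewrite -inS E !inE eqxx orbT.
  have ck : c k != 0 by rewrite -inS E !inE eqxx !orbT.
  have cm : c m != 0 by rewrite -inS E !inE eqxx !orbT.
  move: un; rewrite E /= !inE !negb_or.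
  move=> /and5P[/and4P[ij ik im _] /and3P[jk jm _] /andP[km _] _ _].
  have [eij|eij] := eqVneq (cross (e i) (e j)) 0; first exact: (par i j m).
  (* Cramer's relation between three plane vectors; the case distinction makes its coefficient at
     [k] nonzero. *)
  pose x1 := cross (e j) (e k); pose x2 := cross (e k) (e i).
  pose x3 := cross (e i) (e j).
  apply: (@chain_reduce c (fun h => x1 * (h == i)%:R + x2 * (h == j)%:R + x3 * (h == k)%:R) k m) => //.
  - by rewrite chain_delta /x1 /x2 /x3 /cross; ring.
  - by rewrite chain_delta /x1 /x2 /x3 /cross; ring.
  - move=> h; have [->//|hi] := eqVneq h i; have [->//|hj] := eqVneq h j.
    have [->//|hk] := eqVneq h k.
    by rewrite !mulr0 !addr0 eqxx.
  - rewrite eqxx (eq_sym k i) (negbTE ik) (eq_sym k j) (negbTE jk) !mulr0 !add0r mulr1.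
    exact: eij.
  - rewrite (eq_sym m i) (negbTE im) (eq_sym m j) (negbTE jm) (eq_sym m k) (negbTE km).
    by rewrite !mulr0 !addr0.
Qed.
End circuits.

(** Each edge is replaced by its two side normals, so the polygon becomes a chain of [n.*2] edges
    that passes through [x i] after [i.*2] of them. Additivity of the support function on each pair
    keeps the length. *)
Lemma polygon_fits (R : realType) n0 (s : 'I_n0 -> R * R) (K : set (R * R))
    (Q := conv_hull s) (n : nat) (x : nat -> R * R) :
  interior Q !=set0 -> Defs.convex_set K -> K !=set0 ->
  (forall T, Qnormal_triangle Q T -> fits T K) -> x n = x 0%N ->
  exists t, forall i, (i <= n)%N -> exists z, K z /\
    vadd (x i) t = vscale (\sum_(j < n) hQ Q (vsub (x j.+1) (x j))) z.
Proof.
move=> Q0 cvK K0 QK xn0.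
have /choice[f fP] (i : nat) : exists p : (R * R) * (R * R) * (R * R),
    [/\ side_normal Q p.1.1, side_normal Q p.1.2, 0 <= p.2.1, 0 <= p.2.2 &
      vsub (x i.+1) (x i) = vadd (vscale p.2.1 p.1.1) (vscale p.2.2 p.1.2) /\
      hQ Q (vsub (x i.+1) (x i)) = p.2.1 * hQ Q p.1.1 + p.2.2 * hQ Q p.1.2].
  have [e1 [e2 [c1 [c2 h]]]] := side_decomp (vsub (x i.+1) (x i)) Q0.
  by exists (e1, e2, (c1, c2)).
(* Edge [i] of the polygon contributes the normals of index [i.*2] and [i.*2.+1]. *)
pose E (k : nat) := if odd k then (f k./2).1.2 else (f k./2).1.1.
pose C (k : nat) := if odd k then (f k./2).2.2 else (f k./2).2.1.
pose N := n.*2.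
have nE (k : 'I_N) : side_normal Q (E k).
  by rewrite /E; case: ifP => _; have [] := fP k./2.
have C0 k : 0 <= C k by rewrite /C; case: ifP => _; have [] := fP k./2.
have CS (G : R * R -> R) m : \sum_(k < m.*2) C k * G (E k) =
    \sum_(i < m) ((f i).2.1 * G (f i).1.1 + (f i).2.2 * G (f i).1.2).
  elim: m => [|m IH]; first by rewrite !big_ord0.
  rewrite doubleS !big_ord_recr/= IH -addrA; congr (_ + (_ + _)).
    by rewrite /C /E odd_double doubleK.
  by rewrite /C /E/= odd_double/= uphalf_double.
have tel1 m : \sum_(k < m.*2) C k * (E k).1 = (x m).1 - (x 0%N).1.
  rewrite (CS fst); elim: m => [|m IH]; first by rewrite big_ord0 subrr.
  rewrite big_ord_recr/= IH; have [_ _ _ _ [[h _] _]] := fP m.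
  by rewrite -h /=; ring.
have tel2 m : \sum_(k < m.*2) C k * (E k).2 = (x m).2 - (x 0%N).2.
  rewrite (CS snd); elim: m => [|m IH]; first by rewrite big_ord0 subrr.
  rewrite big_ord_recr/= IH; have [_ _ _ _ [[_ h] _]] := fP m.
  by rewrite -h /=; ring.
have cut (G : nat -> R) M : (M <= N)%N ->
    \sum_(k < N) C k * ((k < M)%N%:R * G k) = \sum_(k < M) C k * G k.
  move=> MN; rewrite (big_ord_widen _ (fun k => C k * G k) MN) [RHS]big_mkcond/=.
  apply: eq_bigr => k _; case: ifP => _; first by rewrite mul1r.
  by rewrite mul0r mulr0.
have [y0 Qy0] := Q0.
have cc : closed_chain (fun k : 'I_N => E k) (fun k => C k).
  by split=> [k //|]; rewrite tel1 tel2 xn0 !subrr.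
have cQ : compact Q by exact: conv_hull_compact.
have [t ht] := @chain_fits_all _ _ _ _ cQ Qy0 cvK K0 QK N _ nE _ cc.
have lenE : chain_len Q (fun k : 'I_N => E k) (fun k => C k) =
    \sum_(j < n) hQ Q (vsub (x j.+1) (x j)).
  rewrite /chain_len (CS (hQ Q)); apply: eq_bigr => i _.
  by have [_ _ _ _ [_ ->]] := fP i.
exists (vsub t (x 0%N)) => i iN; have [z [Kz hz]] := ht i.*2.
exists z; split=> //; rewrite -lenE -hz /chain_pt.
have iN2 : (i.*2 <= N)%N by rewrite leq_double.
rewrite (cut (fun k => (E k).1) _ iN2) (cut (fun k => (E k).2) _ iN2) tel1 tel2.
by rewrite /vadd /vsub/=; congr pair; ring.
Qed.

(** The products of the edges with a point of [Q] bound the length from below and telescope to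
    zero. *)
Lemma polygon_len_ge0 (R : realType) (Q : set (R * R)) n (x : nat -> R * R) :
  compact Q -> Q !=set0 -> x n = x 0%N ->
  0 <= \sum_(j < n) hQ Q (vsub (x j.+1) (x j)).
Proof.
move=> cQ [y Qy] xn0.
have E m : \sum_(j < m) dot (vsub (x j.+1) (x j)) y = dot (vsub (x m) (x 0%N)) y.
  elim: m => [|m IH]; first by rewrite big_ord0 /dot /vsub/=; ring.
  by rewrite big_ord_recr/= IH /dot /vsub/=; ring.
apply: (@le_trans _ _ (\sum_(j < n) dot (vsub (x j.+1) (x j)) y)).
  by rewrite E xn0 /dot /vsub/= !subrr !mul0r addr0.
by apply: ler_sum => j _; exact: hQ_ub.
Qed.

(** * From inscribed polygons to curves *)

Definition partition_bound (R : realType) (Q : set (R * R)) (T a : R)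
    (g : R -> R * R) :=
  forall (n : nat) (t : nat -> R), t 0%N = 0 -> t n = T ->
    (forall i, (i < n)%N -> t i <= t i.+1) ->
    \sum_(i < n) hQ Q (vsub (g (t i.+1)) (g (t i))) <= a.

(** Inscribed polygons have different lengths; padding with [k0] places them all in translates of
    the one body a K + (1 - a) k0, as the compactness argument requires. *)
Lemma polygon_fits_le (R : realType) n0 (s : 'I_n0 -> R * R) (K : set (R * R))
    (Q := conv_hull s) (a : R) (k0 : R * R) (n : nat) (x : nat -> R * R) :
  interior Q !=set0 -> Defs.convex_set K -> K k0 ->
  (forall T, Qnormal_triangle Q T -> fits T K) -> x n = x 0%N ->
  \sum_(j < n) hQ Q (vsub (x j.+1) (x j)) <= a ->
  exists t, forall i, (i <= n)%N -> exists z, K z /\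
    vadd (x i) t = vadd (vscale a z) (vscale (1 - a) k0).
Proof.
move=> Q0 cvK Kk0 QK xn0.
have cQ : compact Q by exact: conv_hull_compact.
have L0 : 0 <= \sum_(j < n) hQ Q (vsub (x j.+1) (x j)).
  by apply: polygon_len_ge0 => //; have [y /interior_subset] := Q0; exists y.
have [|t ht] := @polygon_fits _ _ _ K n x Q0 cvK _ QK xn0; first by exists k0.
move: ht L0; set L := \sum_(j < n) _ => ht L0 La.
exists (vadd t (vscale (1 - L) k0)) => i iN.
have [z [Kz []]] := ht i iN; rewrite /vadd /vscale/= => h1 h2.
have [a0|a0] := eqVneq a 0.
  have L00 : L = 0 by lra.
  exists z; split=> //; rewrite !addrA h1 h2 L00 a0.
  by congr pair; ring.
have ap : 0 < a by rewrite lt_neqAle eq_sym a0/=; lra.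
exists (vadd (vscale (L / a) z) (vscale (1 - L / a) k0)); split.
  by apply: cvK => //; rewrite divr_ge0 ?(ltW ap)//= ler_pdivrMr// mul1r.
by rewrite /vadd /vscale/= !addrA h1 h2; congr pair; field.
Qed.

(** The translations that carry [g u] into a K + (1 - a) k0 form a compact set [A u]. Finitely many
    of these sets meet, by the polygon inscribed at the corresponding times, hence all of them
    do. *)
Lemma curve_fits (R : realType) n0 (s : 'I_n0 -> R * R) (K : set (R * R))
    (Q := conv_hull s) (T a : R) (k0 : R * R) (g : R -> R * R) :
  interior Q !=set0 -> compact K -> Defs.convex_set K -> K k0 ->
  (forall T, Qnormal_triangle Q T -> fits T K) -> 0 <= T -> g T = g 0 ->
  partition_bound Q T a g ->
  exists t, forall u, 0 <= u <= T -> exists z, K z /\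
    vadd (g u) t = vadd (vscale a z) (vscale (1 - a) k0).
Proof.
move=> Q0 cK cvK Kk0 QK T0 gT pb.
pose A u := [set t | exists z, K z /\
  vadd (g u) t = vadd (vscale a z) (vscale (1 - a) k0)].
have cA u : compact (A u).
  have -> : A u = (fun z : R * R => (a * z.1 + ((1 - a) * k0.1 - (g u).1),
                            a * z.2 + ((1 - a) * k0.2 - (g u).2))) @` K.
    apply/seteqP; split => [[t1 t2] [z [Kz [/= h1 h2]]]|_ [z Kz <-]].
      by exists z => //=; congr pair; lra.
    by exists z; split=> //; rewrite /vadd /vscale/=; congr pair; ring.
  apply: continuous_compact => //; apply: continuous_subspaceT => z.
  have c1 r : (a * z0.1 + r) @[z0 --> z] --> a * z.1 + r.
    by apply: cvgD; [apply: cvgMr; exact: cvg_fst|exact: cvg_cst].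
  have c2 r : (a * z0.2 + r) @[z0 --> z] --> a * z.2 + r.
    by apply: cvgD; [apply: cvgMr; exact: cvg_snd|exact: cvg_cst].
  exact: cvg_pair (c1 _) (c2 _).
have hR : hausdorff_space (R * R)%type by exact: norm_hausdorff.
(* Requiring [A 0 t] as well keeps the finite intersections inside one compact set. *)
have finA (l : seq R) : (forall u, u \in l -> 0 <= u <= T) ->
    exists t, A 0 t /\ forall u, u \in l -> A u t.
  move=> lT; pose p := 0 :: rcons (sort <=%O l) T.
  pose x i := g (nth T p i).
  have sz : size (sort <=%O l) = size l by rewrite size_sort.
  have last_p : nth T p (size l).+1 = T.
    by rewrite /p/= nth_rcons sz ltnn eqxx.
  have sp : sorted <=%O p.
    rewrite /p /= rcons_path path_sortedE; last exact: le_trans.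
    rewrite (sort_sorted (@le_total _ _)) andbT all_sort.
    apply/andP; split; first by apply/allP => u /lT /andP[].
    have : last 0 (sort <=%O l) \in 0 :: sort <=%O l by exact: mem_last.
    by rewrite inE => /predU1P[->//|]; rewrite mem_sort => /lT /andP[].
  have [||t ht] := @polygon_fits_le _ _ _ K a k0 (size l).+1 x Q0 cvK Kk0 QK.
  - by rewrite /x last_p /= gT.
  - apply: (pb (size l).+1 (fun i => nth T p i)) => // i iN.
    move/(sortedP T) : sp; apply.
    by rewrite /p /= size_rcons sz.
  exists t; split; first exact: ht 0%N isT.
  move=> u ul; pose i := index u p.
  have up : u \in p by rewrite /p inE mem_rcons inE mem_sort ul !orbT.
  have ip : (i <= (size l).+1)%N.
    have : (i < size p)%N by rewrite index_mem.
    by rewrite [size p]/= size_rcons sz.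
  have [z hz] := ht i ip; exists z.
  by move: hz; rewrite /x nth_index.
have finI_A : finI `[0, T]%classic A.
  move=> D' sub; have [u|t [_ At]] := finA (finmap.enum_fset D').
    by move=> /sub; rewrite inE/= in_itv.
  by exists t => u /= uD; exact: At.
have D0 : `[0, T]%classic 0 by rewrite /= in_itv/= lexx.
have [|t [_ ht]] := cA 0 _ (finI_filter finI_A).
  by exists (A 0) => //; exact: finI_from1.
exists t => u uT; have : closed (A u) by exact: compact_closed.
apply=> B Bt; apply: ht => //; exists (A u) => //.
by apply: finI_from1; rewrite /= in_itv.
Qed.

(** * Absolutely continuous functions *)

(** At the supremum [c] of the times [t] with [G a <= G t], comparison with earlier times puts [c]
    among them, and comparison with later times excludes [c < b]. Continuity of [G] does not
    enter. *)
Lemma locally_nondecreasing (R : realType) (a b : R) (G : R -> R) : a <= b ->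
  (forall t, a <= t <= b -> exists r, 0 < r /\ forall s, a <= s <= b ->
     `|s - t| < r -> (t <= s -> G t <= G s) /\ (s <= t -> G s <= G t)) ->
  G a <= G b.
Proof.
move=> ab loc.
pose S := [set t | a <= t <= b /\ G a <= G t].
have Sa : S a by split; rewrite ?lexx.
have ubS : has_ubound S by exists b => t [/andP[]].
have supS : has_sup S by split; [exists a|].
set c := sup S.
have ac : a <= c by exact: ub_le_sup.
have cb : c <= b by apply: ge_sup => //; [exists a|move=> t [/andP[]]].
have [|r [r0 locc]] := loc c; first by rewrite ac.
have Sc : G a <= G c.
  have [t [tab Gt] ct] := sup_adherent r0 supS.
  have tc : t <= c by apply: ub_le_sup.
  have [|_ /(_ tc)] := locc t tab; last exact: le_trans.
  by rewrite ler0_norm ?subr_le0// opprB; rewrite -/c in ct; lra.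
move: cb; rewrite le_eqVlt => /predU1P[<-//|cb].
pose s := Num.min b (c + r / 2).
have cs : c < s by rewrite lt_min cb/= ltrDl divr_gt0.
have sb : s <= b by rewrite ge_min lexx.
have sr : s <= c + r / 2 by rewrite ge_min lexx orbT.
have [||/(_ (ltW cs)) Gcs _] := locc s.
- by rewrite sb andbT; lra.
- by rewrite gtr0_norm ?subr_gt0//; lra.
have Ss : S s by split; [rewrite sb andbT; lra|exact: le_trans Gcs].
have : s <= c by apply: ub_le_sup.
by rewrite leNgt cs.
Qed.

Definition itv_family (R : realType) (a b : R) (n : nat) (x y : nat -> R) :=
  (forall i, (i < n)%N -> a <= x i /\ x i <= y i /\ y i <= b) /\
  (forall i, (i.+1 < n)%N -> y i <= x i.+1).

Lemma itv_family_le (R : realType) (a b : R) n x y i :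
  itv_family a b n.+1 x y -> (i < n)%N -> y i <= x n.
Proof.
move=> [h1 h2]; elim: n => // n IH in h1 h2 *.
rewrite ltnS leq_eqVlt => /predU1P[->|iN]; first exact: h2.
have h : y i <= x n by apply: IH => // [j jn|j jn]; [apply: h1|apply: h2]; exact: ltnW.
have [_ [xy _]] := h1 n (ltnW (ltnSn _)).
exact: le_trans h (le_trans xy (h2 _ (ltnSn _))).
Qed.

Lemma itv_familyW (R : realType) (a b b' : R) n x y : b <= b' ->
  itv_family a b n x y -> itv_family a b' n x y.
Proof.
move=> bb' [h1 h2]; split=> // i /h1[? [? ?]]; do 2!split => //.
exact: le_trans bb'.
Qed.

Lemma itv_family_rcons (R : realType) (a t s : R) n x y : a <= t -> t <= s ->
  itv_family a t n x y ->
  itv_family a s n.+1 (fun i => if i == n then t else x i)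
                        (fun i => if i == n then s else y i).
Proof.
move=> at_ ts [h1 h2]; split=> i.
  rewrite ltnS leq_eqVlt => /predU1P[->|iN]; first by rewrite eqxx.
  rewrite (ltn_eqF iN); have [? [? ?]] := h1 _ iN; do 2!split => //.
  exact: le_trans ts.
rewrite !ltnS => iN; rewrite (ltn_eqF iN).
case: eqP => [_|/eqP ni].
  by have [_ [_]] := h1 _ iN.
by apply: h2; rewrite ltn_neqAle ni iN.
Qed.

(** Induction on the last interval: the cut [c] moves down to its left endpoint, and a half-open
    interval is disjoint from what lies below the cut. *)
Lemma itv_family_length (R : realType) (a b c : R) n x y (O : set R) :
  measurable O -> itv_family a b n x y ->
  (forall i, (i < n)%N -> `[x i, y i] `<=` O) ->
  (forall i, (i < n)%N -> y i <= c) ->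
  ((\sum_(i < n) (y i - x i))%:E <= (@lebesgue_measure R) (O `&` `]-oo, c]))%E.
Proof.
move=> mO; elim: n c => [|n IH] c fam sub yc; first by rewrite big_ord0.
have [xy nxb] : x n <= y n /\ y n <= c.
  by split; [have [_ []] := fam.1 _ (ltnSn n)|exact: yc].
rewrite big_ord_recr/= EFinD.
have -> : (y n - x n)%:E = (@lebesgue_measure R) `]x n, y n]%classic.
  rewrite lebesgue_measure_itv/= lte_fin; case: ltP => //.
  by move=> yx; congr EFin; lra.
apply: (@le_trans _ _ ((@lebesgue_measure R) (O `&` `]-oo, x n]) +
                       (@lebesgue_measure R) `]x n, y n]%classic)%E).
  rewrite leeD2r//; apply: IH.
  - by split=> i iN; [apply: fam.1|apply: fam.2]; exact: ltnW.
  - by move=> i iN; apply: sub; exact: ltnW.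
  - by move=> i iN; exact: itv_family_le fam iN.
rewrite -measureU//=.
- apply: le_measure; rewrite ?inE//.
  + by apply: measurableU => //; exact: measurableI.
  + by apply: measurableI.
  + move=> z /= [[Oz]|]; rewrite !in_itv/= => h.
      split=> //; lra.
    split; last by lra.
    by apply: (sub n (ltnSn n)) => /=; rewrite in_itv/=; lra.
- by apply: measurableI.
- apply/seteqP; split=> // z /= [[_]]; rewrite !in_itv/=; lra.
Qed.

Lemma ae_lebesgueP (R : realType) (P : R -> Prop) :
  {ae (@lebesgue_measure R), forall x, P x} ->
  exists N : set R, [/\ measurable N, (@lebesgue_measure R) N = 0%E &
    forall x, ~ P x -> N x].
Proof. by move=> [N [mN N0 NP]]; exists N; split => // x; exact: NP. Qed.

Lemma ae_lebesgue_imply (R : realType) (P Q : R -> Prop) :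
  (forall x, P x -> Q x) -> {ae (@lebesgue_measure R), forall x, P x} ->
  {ae (@lebesgue_measure R), forall x, Q x}.
Proof.
by move=> PQ; apply: filterS => //; exact: (ae_filter_ringOfSetsType lebesgue_measure).
Qed.

Lemma ae_lebesgue_and (R : realType) (P Q : R -> Prop) :
  {ae (@lebesgue_measure R), forall x, P x} ->
  {ae (@lebesgue_measure R), forall x, Q x} ->
  {ae (@lebesgue_measure R), forall x, P x /\ Q x}.
Proof.
move=> hP hQ; apply: filterI => //.
exact: (ae_filter_ringOfSetsType lebesgue_measure).
Qed.

(** Only decreases are controlled. This suits a difference such as total variation minus a Lipschitz
    primitive, where increases carry no such bound. *)
Definition lower_abs_cont (R : realType) (a b : R) (H : R -> R) :=
  forall e, 0 < e -> exists d, 0 < d /\ forall n x y, itv_family a b n x y ->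
    \sum_(i < n) (y i - x i) < d -> \sum_(i < n) (H (x i) - H (y i)) < e.

(** Nonnegativity of the lower Dini derivatives at [t], from both sides, without assuming a
    derivative. *)
Definition lower_dini_ge0 (R : realType) (a b : R) (H : R -> R) (t : R) :=
  forall e, 0 < e -> exists r, 0 < r /\ forall s, a <= s <= b -> `|s - t| < r ->
    (t <= s -> - (e * (s - t)) <= H s - H t) /\
    (s <= t -> - (e * (t - s)) <= H t - H s).

(* The null set where the derivative is not controlled is covered by an open
   set [O] of small measure; adding to [H] the total decrease [V] of [H] along
   intervals contained in [O] makes it locally nondecreasing everywhere. *)
Lemma lower_dini_nondecreasing (R : realType) (a b : R) (H : R -> R) : a <= b ->
  lower_abs_cont a b H ->
  {ae (@lebesgue_measure R), forall t, a <= t <= b -> lower_dini_ge0 a b H t} ->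
  H a <= H b.
Proof.
move=> ab acH /ae_lebesgueP[N [mN N0 NP]].
suff small e : 0 < e -> H a <= H b + e * (1 + (b - a)).
  apply/ler_addgt0Pr => e e0.
  have c0 : 0 < 1 + (b - a) by lra.
  have := small (e / (1 + (b - a))) (divr_gt0 e0 c0).
  by rewrite divfK// gt_eqF.
move=> e0; have [d [d0 acd]] := acH e e0.
have [|O [oO NO Od]] := lebesgue_regularity_outer mN _ d0.
  by rewrite [X in (X < _)%E](_ : _ = 0%E)// ltry.
have {}Od : ((@lebesgue_measure R) (O `\` N) < d%:E)%E by exact: Od.
have mO : measurable O by exact: open_measurable.
have {}Od : ((@lebesgue_measure R) O < d%:E)%E.
  rewrite -(setDUK NO) measureU//; last 2 first.
    exact: measurableD.
    by rewrite setDIK.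
  by rewrite [X in (X + _)%E](_ : _ = 0%E) ?add0e//; exact: N0.
pose D t := [set S | exists n x y, itv_family a t n x y /\
   (forall i, (i < n)%N -> `[x i, y i] `<=` O) /\
   S = \sum_(i < n) (H (x i) - H (y i))].
have D0 t : D t 0.
  by exists 0%N, (fun=> 0), (fun=> 0); split; [split|rewrite big_ord0].
have De t : t <= b -> ubound (D t) e.
  move=> tb S [n [x [y [fam [sub ->]]]]]; apply/ltW/acd.
    exact: itv_familyW fam.
  rewrite -lte_fin; apply: le_lt_trans Od.
  have yt i : (i < n)%N -> y i <= t by move=> /(fam.1)[_ []].
  apply: le_trans (itv_family_length mO fam sub yt) _.
  by apply: le_measure; rewrite ?inE//; exact: measurableI.
pose V t := sup (D t).
have Vub t S : t <= b -> D t S -> S <= V t.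
  by move=> tb DS; apply: ub_le_sup => //; exists e; exact: De.
have V0 t : t <= b -> 0 <= V t by move=> tb; exact: Vub.
have Ve t : t <= b -> V t <= e.
  by move=> tb; apply: ge_sup; [exists 0|exact: De].
have Vmono t s : t <= s -> s <= b -> V t <= V s.
  move=> ts sb; apply: ge_sup; first by exists 0.
  move=> S [n [x [y [fam sub]]]]; apply: Vub => //.
  by exists n, x, y; split=> //; exact: itv_familyW fam.
have Vstep t s : a <= t -> t <= s -> s <= b -> `[t, s] `<=` O ->
    V t + (H t - H s) <= V s.
  move=> at_ ts sb tsO; rewrite -lerBrDr; apply: ge_sup; first by exists 0.
  move=> S [n [x [y [fam [sub ->]]]]]; rewrite lerBrDr; apply: Vub => //.
  exists n.+1, (fun i => if i == n then t else x i),
               (fun i => if i == n then s else y i); split.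
    exact: itv_family_rcons.
  split=> [i|].
    rewrite ltnS leq_eqVlt => /predU1P[->|iN]; first by rewrite eqxx.
    by rewrite (ltn_eqF iN); exact: sub.
  rewrite big_ord_recr/= eqxx; congr (_ + _); apply: eq_bigr => i _.
  by rewrite (ltn_eqF (ltn_ord i)).
(* At points of [O] the term [V] compensates the decrease of [H]; at the other points the slope [e]
   compensates the error in the Dini condition. Both terms cost at most [e * (1 + (b - a))]. *)
pose G t := H t + V t + e * (t - a).
suff : G a <= G b.
  rewrite /G; have := V0 a ab; have := Ve b (lexx b); lra.
apply: locally_nondecreasing => // t /andP[at_ tb].
have [Ot|nOt] := pselect (O t).
  have /nbhs_ballP[r /= r0 rO] := open_nbhs_nbhs (conj oO Ot).
  exists r; split=> // s /andP[as_ sb] str; split=> ts.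
    have := Vstep t s at_ ts sb; rewrite /G => h.
    have {}h := h _; have : V t + (H t - H s) <= V s.
      apply: h => z /=; rewrite in_itv/= => /andP[tz zs]; apply: rO.
      rewrite /ball/= ler0_norm; last by lra.
      by move: str; rewrite ger0_norm; lra.
    have : 0 <= e * (s - t) by rewrite mulr_ge0//; lra.
    lra.
  have := Vstep s t as_ ts tb; rewrite /G => h.
  have : V s + (H s - H t) <= V t.
    apply: h => z /=; rewrite in_itv/= => /andP[tz zs]; apply: rO.
    rewrite /ball/= ger0_norm; last by lra.
    by move: str; rewrite ler0_norm; lra.
  have : 0 <= e * (t - s) by rewrite mulr_ge0//; lra.
  lra.
have [r [r0 hr]] : exists r, 0 < r /\ forall s, a <= s <= b -> `|s - t| < r ->
    (t <= s -> - (e * (s - t)) <= H s - H t) /\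
    (s <= t -> - (e * (t - s)) <= H t - H s).
  apply: contrapT => h; apply: nOt; apply: NO; apply: NP => /= /(_ _)h'.
  by apply: h; apply: h' => //; rewrite at_.
exists r; split=> // s sab str; have [h1 h2] := hr s sab str.
move: sab => /andP[as_ sb]; split=> ts.
  have := h1 ts; have := Vmono _ _ ts sb; rewrite /G; lra.
have := h2 ts; have := Vmono _ _ ts tb; rewrite /G; lra.
Qed.

Lemma abs_cont_lower (R : realType) (a b : R) (f : R -> R) :
  abs_cont a b f -> lower_abs_cont a b f.
Proof.
move=> acf e /acf[d [d0 h]]; exists d; split=> // n x y [h1 h2] xyd.
apply: le_lt_trans (h n x y h1 h2 xyd); apply: ler_sum => i _.
by rewrite distrC ler_norm.
Qed.

Lemma abs_contS (R : realType) (a b a' b' : R) (f : R -> R) :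
  a <= a' -> b' <= b -> abs_cont a b f -> abs_cont a' b' f.
Proof.
move=> aa bb acf e /acf[d [d0 h]]; exists d; split=> // n x y h1.
by apply: h => i /h1[? [? ?]]; split; [|split=> //]; lra.
Qed.

Lemma abs_cont_comb (R : realType) (a b M : R) (f g h : R -> R) :
  abs_cont a b f -> abs_cont a b g ->
  (forall s t, a <= s <= b -> a <= t <= b ->
    `|h t - h s| <= M * (`|f t - f s| + `|g t - g s|)) -> abs_cont a b h.
Proof.
move=> acf acg fgh e e0.
have M0 : 0 < `|M| + 1 by have := normr_ge0 M; lra.
have e'0 : 0 < e / (2 * (`|M| + 1)) by rewrite divr_gt0// mulr_gt0.
have [d1 [d10 h1]] := acf _ e'0; have [d2 [d20 h2]] := acg _ e'0.
exists (Num.min d1 d2); split; first by rewrite lt_min d10.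
move=> n x y hx hy; rewrite lt_min => /andP[xy1 xy2].
have {}h1 := h1 _ _ _ hx hy xy1; have {}h2 := h2 _ _ _ hx hy xy2.
apply: (@le_lt_trans _ _ (\sum_(i < n) (`|M| + 1) *
    (`|f (y i) - f (x i)| + `|g (y i) - g (x i)|))).
  apply: ler_sum => i _; have [ax [xy yb]] := hx i (ltn_ord i).
  apply: le_trans (fgh _ _ _ _) _; [lra|lra|].
  by rewrite ler_wpM2r ?addr_ge0//; have := ler_norm M; lra.
rewrite -mulr_sumr big_split/= mulrC -ltr_pdivlMr//.
have -> : e / (`|M| + 1) = e / (2 * (`|M| + 1)) + e / (2 * (`|M| + 1)).
  by field; lra.
exact: ltrD.
Qed.

Lemma abs_cont_lin (R : realType) (a b c d : R) (f g : R -> R) :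
  abs_cont a b f -> abs_cont a b g -> abs_cont a b (fun t => c * f t + d * g t).
Proof.
move=> acf acg; apply: (@abs_cont_comb _ _ _ (`|c| + `|d|) f g) => // s t _ _.
have -> : c * f t + d * g t - (c * f s + d * g s) =
  c * (f t - f s) + d * (g t - g s) by ring.
apply: le_trans (ler_normD _ _) _; rewrite !normrM.
have := normr_ge0 c; have := normr_ge0 d.
have := normr_ge0 (f t - f s); have := normr_ge0 (g t - g s); nra.
Qed.

Lemma lipschitz_abs_cont (R : realType) (a b M : R) (f : R -> R) :
  (forall s t, a <= s -> s <= t -> t <= b -> `|f t - f s| <= M * (t - s)) ->
  abs_cont a b f.
Proof.
move=> fM e e0.
have M0 : 0 < `|M| + 1 by have := normr_ge0 M; lra.
exists (e / (`|M| + 1)); split; first by rewrite divr_gt0.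
move=> n x y hx hy; rewrite ltr_pdivlMr// => xye; apply: le_lt_trans xye.
rewrite mulr_suml; apply: ler_sum => i _.
have [ax [xy yb]] := hx i (ltn_ord i).
apply: le_trans (fM _ _ ax xy yb) _.
by rewrite mulrC ler_wpM2l//; have := ler_norm M; lra.
Qed.

Lemma abs_cont_dist (R : realType) (a b : R) (f : R -> R) : abs_cont a b f ->
  forall e, 0 < e -> exists d, 0 < d /\ forall s t,
    a <= s <= b -> a <= t <= b -> `|s - t| < d -> `|f s - f t| < e.
Proof.
move=> acf e /acf[d [d0 h]]; exists d; split=> // s t.
wlog st : s t / t <= s.
  move=> wl hs ht; have [|/ltW] := leP t s; first by move=> ts; apply: wl.
  by move=> ts; rewrite distrC (distrC (f s)); apply: wl.
move=> /andP[as_ sb] /andP[at_ tb]; rewrite ger0_norm; last by lra.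
move=> std; have := h 1%N (fun=> t) (fun=> s); rewrite !big_ord1; apply=> //.
Qed.

(** Composition with [clamp] extends a function on the interval to the whole line, constantly
    outside. *)
Definition clamp (R : realType) (a b t : R) := Num.max a (Num.min b t).

Lemma clamp_itv (R : realType) (a b t : R) : a <= b -> a <= clamp a b t <= b.
Proof. by move=> ab; rewrite /clamp le_max lexx/= ge_max ab ge_min lexx. Qed.

Lemma clamp_id (R : realType) (a b t : R) : a <= t <= b -> clamp a b t = t.
Proof. by move=> /andP[at_ tb]; rewrite /clamp (min_idPr tb) (max_idPr at_). Qed.

Lemma clamp_dist (R : realType) (a b s t : R) : a <= b ->
  `|clamp a b s - clamp a b t| <= `|s - t|.
Proof.
move=> ab; have := ler_norm (s - t); have := ler_norm (t - s).
rewrite (distrC t) ler_norml /clamp.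
by case: (leP b s) => ?; case: (leP b t) => ?; case: (leP a s) => ?;
  case: (leP a t) => ?; rewrite ?(max_idPr ab); lra.
Qed.

Lemma abs_cont_clamp_continuous (R : realType) (a b : R) (f : R -> R) :
  a <= b -> abs_cont a b f -> continuous (fun t => f (clamp a b t)).
Proof.
move=> ab acf t; apply/cvgrPdist_lt => e e0.
have [d [d0 h]] := abs_cont_dist acf e0.
near=> s; apply: h; [exact: clamp_itv..|].
apply: le_lt_trans (clamp_dist _ _ ab) _.
by near: s; apply: cvgr_dist_lt.
Unshelve. all: by end_near. Qed.

Lemma abs_cont_bounded (R : realType) (a b : R) (f : R -> R) :
  a <= b -> abs_cont a b f -> exists M, forall t, a <= t <= b -> `|f t| <= M.
Proof.
move=> ab acf; pose g t := `|f (clamp a b t)|.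
have gc : {within `[a, b], continuous g}.
  apply: continuous_subspaceT => t.
  by apply: cvg_norm; exact: abs_cont_clamp_continuous.
have [c _ hc] := EVT_max ab gc; exists (g c) => t tab.
by have := hc t; rewrite in_itv/= => /(_ tab); rewrite /g clamp_id.
Qed.

Lemma abs_contM (R : realType) (a b : R) (f g : R -> R) : a <= b ->
  abs_cont a b f -> abs_cont a b g -> abs_cont a b (fun t => f t * g t).
Proof.
move=> ab acf acg.
have [M1 h1] := abs_cont_bounded ab acf; have [M2 h2] := abs_cont_bounded ab acg.
apply: (@abs_cont_comb _ _ _ (M1 + M2) f g) => // s t sab tab.
have -> : f t * g t - f s * g s = f t * (g t - g s) + (f t - f s) * g s by ring.
apply: le_trans (ler_normD _ _) _; rewrite !normrM.
have := h1 t tab; have := h2 s sab.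
have := normr_ge0 (f t - f s); have := normr_ge0 (g t - g s).
have := normr_ge0 (f t); have := normr_ge0 (g s); nra.
Qed.

Lemma derivable_expansion (R : realType) (f : R -> R) (t : R) :
  derivable f t 1 -> forall e, 0 < e -> exists r, 0 < r /\ forall s,
    `|s - t| < r -> `|f s - f t - derive1 f t * (s - t)| <= e * `|s - t|.
Proof.
move=> df e e0.
have /cvgrPdist_le/(_ e e0) : h^-1 *: (f (h + t) - f t) @[h --> 0^'] --> derive1 f t.
  suff : cvg (h^-1 *: (f (h + t) - f t) @[h --> 0^']) by [].
  have := df; rewrite /derivable.
  have -> : (fun h : R => h^-1 *: (f (h *: 1 + t) - f t)) =
            (fun h => h^-1 *: (f (h + t) - f t)).
    by apply/funext => h; rewrite [h *: 1]mulr1.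
  by [].
move=> /nbhs_ballP[r /= r0 hr]; exists r; split=> // s str.
have [->|st] := eqVneq s t; first by rewrite !subrr mulr0 subr0 normr0 mulr0.
have st0 : s - t != 0 by rewrite subr_eq0.
have := hr (s - t); rewrite /ball/= sub0r normrN => /(_ str st0).
rewrite /= subrK /GRing.scale/= => h.
have -> : f s - f t - derive1 f t * (s - t) =
  - ((derive1 f t - (s - t)^-1 * (f s - f t)) * (s - t)) by field.
by rewrite normrN normrM ler_wpM2r.
Qed.

Lemma derivable_lower_dini (R : realType) (a b : R) (f : R -> R) (t : R) :
  derivable f t 1 -> 0 <= derive1 f t -> lower_dini_ge0 a b f t.
Proof.
move=> df f0 e e0; have [r [r0 h]] := derivable_expansion df e0.
exists r; split=> // s _ /h{}h; split=> st; move: h.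
  rewrite (@ger0_norm _ (s - t)) ?subr_ge0// ler_norml => /andP[h _].
  have : 0 <= derive1 f t * (s - t) by rewrite mulr_ge0// subr_ge0.
  lra.
rewrite (@ler0_norm _ (s - t)) ?subr_le0// ler_norml => /andP[_ h].
have : 0 <= derive1 f t * (t - s) by rewrite mulr_ge0// subr_ge0.
lra.
Qed.

Lemma abs_cont_nondecreasing (R : realType) (a b : R) (f : R -> R) : a <= b ->
  abs_cont a b f ->
  {ae (@lebesgue_measure R), forall t, a <= t <= b ->
    derivable f t 1 /\ 0 <= derive1 f t} -> f a <= f b.
Proof.
move=> ab acf df; apply: lower_dini_nondecreasing => //.
  exact: abs_cont_lower.
apply: ae_lebesgue_imply df => t h /h[? ?]; exact: derivable_lower_dini.
Qed.

(** * The fundamental theorem of calculus *)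

Section null_set.
Import HBNNSimple.
Local Open Scope ereal_scope.

(* No measurability of [f] and [g] is assumed: the integral of a nonnegative
   function is a supremum over the simple functions below it, and these can be
   set to zero on [N]. *)
Lemma ge0_le_integral_null d (T : measurableType d) (R : realType)
    (mu : {measure set T -> \bar R}) (f g : T -> \bar R) (N : set T) :
  measurable N -> mu N = 0 -> (forall x, 0 <= f x) -> (forall x, 0 <= g x) ->
  (forall x, ~ N x -> f x <= g x) -> \int[mu]_x f x <= \int[mu]_x g x.
Proof.
move=> mN N0 f0 g0 fg; rewrite !ge0_integralTE//.
apply: ge_ereal_sup => _ [h/= hf <-].
have mNC : measurable (~` N) by exact: measurableC.
have E x : proj_nnsfun h mNC x = (h x * \1_(~` N) x)%R by [].
apply: ereal_sup_ubound; exists (proj_nnsfun h mNC).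
  move=> x; rewrite E indicE.
  have [Nx|Nx] := pselect (N x).
    by rewrite memNset/= ?mulr0.
  by rewrite mem_set// mulr1; apply: le_trans (hf x) _; exact: fg.
rewrite -!integralT_nnsfun; apply: ge0_ae_eq_integral => //.
- exact/measurable_EFinP.
- exact/measurable_EFinP.
- by move=> x _; rewrite lee_fin.
- by move=> x _; rewrite lee_fin.
- exists N; split=> // x /=; apply: contra_notP => Nx _.
  by congr EFin; have := E x; rewrite indicE mem_set ?mulr1.
Qed.

(** Positive and negative parts are compared in both directions. No regularity of [f] is asked,
    because the integrand of the action is arbitrary on the exceptional null set. *)
Lemma integral_setD_null d (T : measurableType d) (R : realType)
    (mu : {measure set T -> \bar R}) (f : T -> \bar R) (A N : set T) :
  measurable N -> mu N = 0 ->
  \int[mu]_(x in A) f x = \int[mu]_(x in A `\` N) f x.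
Proof.
move=> mN N0; rewrite (integral_mkcond A) (integral_mkcond (A `\` N)).
have E x : ~ N x -> (f \_ A) x = (f \_ (A `\` N)) x.
  move=> Nx; rewrite /patch; congr (if _ then _ else _).
  by apply/idP/idP; rewrite !inE => // -[].
rewrite (integralE _ _ (f \_ A)) (integralE _ _ (f \_ (A `\` N))).
by congr (_ - _); apply/eqP; rewrite eq_le; apply/andP; split;
  apply: (ge0_le_integral_null mN) => // x Nx; rewrite ?funeposE ?funenegE E.
Qed.
End null_set.

Lemma family_trivIset (R : realType) (a b : R) n x y : itv_family a b n x y ->
  trivIset [set: 'I_n] (fun i => `]x i, y i]%classic).
Proof.
move=> fam; have h (i j : 'I_n) : (i < j)%N -> y i <= x j.
  move=> ij; have fam' : itv_family a b j.+1 x y.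
    split=> k; [move=> kj; apply: fam.1|move=> kj; apply: fam.2];
    apply: leq_trans kj _; exact: ltn_ord.
  exact: itv_family_le fam' ij.
apply/trivIsetP => i j _ _ ij; apply/seteqP; split=> // z /=.
rewrite !in_itv/= => -[/andP[h1 h2] /andP[h3 h4]].
move: ij; rewrite -val_eqE neq_ltn => /orP[]/h; lra.
Qed.

Lemma integrable_cst_fin d (T : measurableType d) (R : realType)
    (mu : {measure set T -> \bar R}) (D : set T) (M : R) :
  measurable D -> (mu D < +oo)%E -> mu.-integrable D (EFin \o (fun=> M)).
Proof.
move=> mD Dy; apply/integrableP; split.
  exact/measurable_EFinP/measurable_cst.
rewrite (eq_integral (cst `|M|%:E))// integral_cst//.
by rewrite lte_mul_pinfty.
Qed.

Section primitive.
Variables (R : realType) (g : R -> R) (a : R).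
Hypothesis ig : (@lebesgue_measure R).-integrable setT (EFin \o g).
Let G t := \int[@lebesgue_measure R]_(s in `[a, t]) g s.

Lemma primitiveB s t : a <= s -> s <= t ->
  G t - G s = \int[@lebesgue_measure R]_(u in `]s, t]) g u.
Proof.
by move=> as_ st; rewrite Rintegral_itvB//; exact: integrableS ig.
Qed.

Lemma primitive_derivable : {ae (@lebesgue_measure R), forall t, a < t ->
  derivable G t 1 /\ derive1 G t = g t}.
Proof.
have h := @FTC1 R g (BLeft a).
apply: ae_lebesgue_imply (h _ _) => [t ht at_|y|].
- by apply: ht; rewrite lte_fin.
- exact: integrableS ig.
- exact: open_integrable_locally openT ig.
Qed.

(** The integral of [|g|] over a set of small measure is small; the set is the disjoint union of the
    half-open intervals of the family. *)
Lemma primitive_abs_cont b : abs_cont a b G.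
Proof.
move=> e e0; have [d [d0 hd]] := integral_normr_continuous ig e0.
exists d; split=> // n x y h1 h2 xyd.
have fam : itv_family a b n x y by split.
pose F (i : 'I_n) := `]x i, y i]%classic.
have mF i : measurable (F i) by exact: measurable_itv.
have tF : trivIset [set` (index_enum 'I_n)] F.
  by apply: sub_trivIset (family_trivIset fam).
pose U := \big[setU/set0]_(i < n) F i.
have mU : measurable U by exact: bigsetU_measurable.
have Ud : ((@lebesgue_measure R) U < d%:E)%E.
  have -> : ((@lebesgue_measure R) U = \sum_(i < n) (@lebesgue_measure R) (F i))%E.
    exact: (@measure_bigsetU_ord _ _ _ lebesgue_measure n xpredT F mF
      (family_trivIset fam)).
  rewrite (eq_bigr (fun i : 'I_n => (y i - x i)%:E)) ?sumEFin ?lte_fin// => i _.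
  have [_ [xy _]] := h1 i (ltn_ord i).
  rewrite lebesgue_measure_itv/= lte_fin; case: ltP => // yx.
  by congr EFin; lra.
have iabs A : measurable A ->
    (@lebesgue_measure R).-integrable A (EFin \o (fun x => `|g x|)).
  move=> mA; apply: (@integrableS _ _ _ _ setT) => //.
  exact: integrable_norm ig.
apply: le_lt_trans (hd U mU Ud).
rewrite -lee_fin /Rintegral fineK; last exact: integrable_fin_num (iabs U mU).
rewrite ge0_integral_bigsetU ?index_enum_uniq//; last first.
  exact: measurable_int (iabs U mU).
rewrite -sumEFin; apply: lee_sum => i _.
have [ax [xy yb]] := h1 i (ltn_ord i).
have -> : (\int[@lebesgue_measure R]_(u in F i) (`|g u|)%:E)%E =
    (\int[@lebesgue_measure R]_(u in F i) `|g u|)%:E.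
  rewrite /Rintegral fineK//.
  by apply: integrable_fin_num; [exact: mF|exact: iabs (mF i)].
rewrite lee_fin primitiveB//.
have iF : (@lebesgue_measure R).-integrable (F i) (EFin \o g).
  by apply: integrableS ig => //; exact: mF.
by apply: le_normr_Rintegral; [exact: mF|exact: iF].
Qed.

Lemma primitive_le M s t : a <= s -> s <= t -> (forall u, g u <= M) ->
  G t - G s <= M * (t - s).
Proof.
move=> as_ st gM; rewrite primitiveB//.
have fin : ((@lebesgue_measure R) `]s, t]%classic < +oo)%E.
  by rewrite lebesgue_measure_itv/=; case: ifP => // _; rewrite -EFinD ltry.
have /le_trans : \int[@lebesgue_measure R]_(u in `]s, t]) g u <=
    \int[@lebesgue_measure R]_(u in `]s, t]) M.
  apply: le_Rintegral => //; first exact: integrableS ig.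
  exact: integrable_cst_fin.
apply; rewrite Rintegral_cst// [X in fine X]lebesgue_measure_itv/= lte_fin.
by case: ltP => //= ts; have -> : t - s = 0 by lra.
Qed.
End primitive.

(** * Total variation of absolutely continuous functions *)

Lemma abs_cont_TV_local (R : realType) (a b : R) (f : R -> R) : abs_cont a b f ->
  exists d, 0 < d /\ forall c c', a <= c -> c <= c' -> c' <= b -> c' - c < d ->
    (total_variation c c' f <= 1)%E.
Proof.
move=> acf; have [d [d0 h]] := acf 1 ltr01; exists d; split=> // c c' ac cc cb ccd.
apply: ge_ereal_sup => _ [_ [s sP <-] <-]; rewrite lee_fin /variation.
pose x i := nth c' (c :: s) i; pose y i := nth c' s i.
have [sp sl] := sP.
have xy i : (i < size s)%N -> x i < y i by move: i; apply/pathP.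
have xge i : (i <= size s)%N -> c <= x i.
  by move=> iN; exact: itv_partition_nth_ge sP.
have xle i : (i <= size s)%N -> x i <= c'.
  by move=> iN; exact: itv_partition_nth_le sP.
apply/ltW; rewrite big_mkord; apply: (h (size s) x y).
- move=> i iN; split; first exact: le_trans ac (xge _ (ltnW iN)).
  by split; [exact/ltW/xy|exact: le_trans (xle i.+1 iN) cb].
- by move=> i _; rewrite lexx.
- apply: le_lt_trans ccd; rewrite -(big_mkord xpredT (fun i => y i - x i)).
  rewrite (eq_bigr (fun i => x i.+1 - x i))// telescope_sumr//.
  have -> : x (size s) = c' by exact: (itv_partition_nth_size c' sP).
  by [].
Qed.

(** Advancing by steps of length [d / 2], each of variation at most 1, exhausts the interval after
    finitely many steps. *)
Lemma abs_cont_TV (R : realType) (a b : R) (f : R -> R) : a <= b ->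
  abs_cont a b f -> (total_variation a b f < +oo)%E.
Proof.
move=> ab acf; have [d [d0 h]] := abs_cont_TV_local acf.
have e0 : 0 < d / 2 by rewrite divr_gt0.
suff H k c : a <= c -> c <= b -> c <= a + k%:R * (d / 2) ->
    (total_variation a c f < +oo)%E.
  apply: (H (Num.bound ((b - a) / (d / 2)))) => //.
  rewrite -lerBlDl -ler_pdivrMr//; apply/ltW/archi_boundP.
  by rewrite divr_ge0 ?subr_ge0// ltW.
elim: k c => [|k IH] c ac cb.
  rewrite mul0r addr0 => ca; have -> : c = a by lra.
  by rewrite total_variationxx ltry.
move=> ck; pose c' := Num.max a (c - d / 2).
have ac' : a <= c' by rewrite le_max lexx.
have c'c : c' <= c by rewrite ge_max ac/=; lra.
have c'd : c - d / 2 <= c' by rewrite le_max lexx orbT.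
rewrite (total_variationD f ac' c'c) lte_add_pinfty//.
  apply: IH => //; first exact: le_trans cb.
  rewrite ge_max -addn1 natrD in ck *; apply/andP; split; last by lra.
  by rewrite lerDl mulr_ge0// ltW.
apply: le_lt_trans (h _ _ ac' c'c cb _) (ltry _); lra.
Qed.

Lemma abs_cont_TV_incr (R : realType) (a b : R) (f : R -> R) s t :
  abs_cont a b f -> a <= s -> s <= t -> t <= b ->
  `|f t - f s| <= fine (total_variation a t f) - fine (total_variation a s f).
Proof.
move=> acf as_ st tb.
have fin x y : a <= x -> x <= y -> y <= b -> total_variation x y f \is a fin_num.
  move=> ax xy yb; rewrite ge0_fin_numE ?total_variation_ge0//.
  by apply: abs_cont_TV => //; exact: abs_contS acf.
have fs := fin _ _ (lexx a) as_ (le_trans st tb); have ft := fin _ _ as_ st tb.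
rewrite (total_variationD f as_ st) fineD// addrAC subrr add0r -lee_fin fineK//.
exact: total_variation_ge.
Qed.

Section FTC.
Variables (R : realType) (a b : R) (F : R -> R) (N : set R).
Hypotheses (ab : a < b) (acF : abs_cont a b F).
Hypotheses (mN : measurable N) (N0 : (@lebesgue_measure R) N = 0%E).
Let D : set R := `]a, b[%classic `\` N.
Hypothesis dF : forall t, D t -> derivable F t 1.
Let mu := @lebesgue_measure R.

Lemma measurable_dom : measurable D.
Proof. by apply: measurableD => //; exact: measurable_itv. Qed.
Let mD := measurable_dom.

(** On [D] the derivative is the limit of the difference quotients of the clamped function with
    steps [n.+1%:R^-1], which are measurable. *)
Lemma measurable_derive1 : measurable_fun D (derive1 F).
Proof.
pose Fc t := F (clamp a b t).
have mFc : measurable_fun setT Fc.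
  by apply: continuous_measurable_fun; exact: abs_cont_clamp_continuous (ltW ab) acF.
pose h (n : nat) t := n.+1%:R * (Fc (t + n.+1%:R^-1) - Fc t).
apply: (@measurable_fun_cvg _ _ _ _ h) => [n|t [/=]].
  apply: measurable_funTS; apply: measurable_funM => //.
  apply: measurable_funB => //.
  apply: (measurableT_comp mFc).
  exact: measurable_funD.
rewrite in_itv/= => /andP[at_ tb] nNt.
have dFt : derivable F t 1 by apply: dF; split=> //=; rewrite in_itv/= at_.
apply/cvgrPdist_le => e e0; have [r [r0 hr]] := derivable_expansion dFt e0.
have m0 : 0 < Num.min r (b - t) by rewrite lt_min r0 subr_gt0.
near=> n.
have n0 : 0 < n.+1%:R^-1 :> R by rewrite invr_gt0.
have : n.+1%:R^-1 < Num.min r (b - t).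
  by near: n; exact: (near_infty_natSinv_lt (PosNum m0)).
have nq : n.+1%:R * n.+1%:R^-1 = 1 :> R by rewrite mulfV// pnatr_eq0.
rewrite lt_min /h /Fc => /andP[]; move: n0 nq; set q := n.+1%:R^-1 => n0 nq nr nb.
have tq : a <= t + q <= b by apply/andP; split; lra.
rewrite (clamp_id tq) clamp_id ?(ltW at_) ?(ltW tb)//.
have := hr (t + q); rewrite (addrC t) addrK gtr0_norm// => /(_ nr) hn.
rewrite distrC.
have -> : n.+1%:R * (F (q + t) - F t) - derive1 F t =
  n.+1%:R * (F (q + t) - F t - derive1 F t * q).
  by rewrite [RHS]mulrBr (mulrCA _ (derive1 F t)) nq mulr1.
rewrite normrM ger0_norm//; apply: le_trans (ler_wpM2l _ hn) _ => //.
by rewrite mulrCA nq mulr1.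
Unshelve. all: by end_near. Qed.

Let f : R -> R := derive1 F \_ D.

Let mf : measurable_fun setT f.
Proof. by apply/(measurable_restrictT (derive1 F) mD); exact: measurable_derive1. Qed.

Let fE t : D t -> f t = derive1 F t.
Proof. by move=> Dt; rewrite /f patchE mem_set. Qed.

Let f0 t : ~ (a <= t <= b) -> f t = 0.
Proof.
move=> tab; rewrite /f patchE memNset// => -[/=].
by rewrite in_itv/= => /andP[at_ tb] _; apply: tab; rewrite !ltW.
Qed.

(** Truncating [|F'|] makes its primitive Lipschitz, so that it can be compared with the total
    variation before [F'] is known to be integrable. *)
Let g (M : nat) t := Num.min `|f t| M%:R.

Let g0 M t : 0 <= g M t.
Proof. by rewrite le_min normr_ge0 ler0n. Qed.

Let gM M t : g M t <= M%:R.
Proof. by rewrite ge_min lexx orbT. Qed.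

Let mg M : measurable_fun setT (g M).
Proof. by apply: measurable_minr => //; exact: measurableT_comp. Qed.

Let g_out M t : ~ (a <= t <= b) -> g M t = 0.
Proof. by move=> /f0 ft; rewrite /g ft normr0; apply/min_idPl. Qed.

Let ig M : mu.-integrable setT (EFin \o g M).
Proof.
have mab : measurable (`[a, b]%classic : set R) by exact: measurable_itv.
have fin : ((@lebesgue_measure R) `[a, b]%classic < +oo)%E.
  by rewrite lebesgue_measure_itv/=; case: ifP => // _; rewrite -EFinD ltry.
apply: (@le_integrable _ _ _ lebesgue_measure setT measurableT (EFin \o g M)
  (EFin \o (((fun=> M%:R) : R -> R) \_ `[a, b]))) => //.
- by apply/measurable_EFinP; exact: mg.
- move=> t _ /=; rewrite lee_fin patchE; case: ifPn => [_|].
    by rewrite !ger0_norm.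
  by rewrite notin_setE/= in_itv/= => /g_out ->.
- rewrite -restrict_EFin; apply/integrable_restrict => //; rewrite setTI.
  by apply: integrable_cst_fin => //; exact: fin.
Qed.

Let int_ab (h : R -> R) : (forall t, ~ (a <= t <= b) -> h t = 0) ->
  (\int[mu]_t (h t)%:E = \int[mu]_(t in `[a, b]) (h t)%:E)%E.
Proof.
move=> h0; rewrite [RHS]integral_mkcond; apply: eq_integral => t _.
rewrite patchE; case: ifPn => //; rewrite notin_setE/= in_itv/= => /h0 ->//.
Qed.

Let ae_D : {ae mu, forall t, a <= t <= b -> D t}.
Proof.
exists (N `|` [set a; b]); split.
- by do 2?apply: measurableU => //.
- have h2 : (@lebesgue_measure R) [set a; b] = 0%E.
    rewrite -(lebesgue_measure_set1 a); apply: measureU0 => //.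
    exact: lebesgue_measure_set1.
  rewrite -N0; apply: measureU0 => //; exact: measurableU.
- move=> t /=; apply: contra_notP => /not_orP[nN /not_orP[ta tb] /andP[at_ tb']].
  split=> //=; rewrite in_itv/= !lt_neqAle at_ tb' !andbT.
  by apply/andP; split; apply/eqP => // /esym.
Qed.

(* The total variation grows at least at rate [|F'|], hence dominates the
   integral of the truncations of [|F'|]. *)
Let g_bound M :
  (\int[mu]_t (g M t)%:E <= (fine (total_variation a b F))%:E)%E.
Proof.
rewrite int_ab; last exact: g_out.
pose G t := \int[mu]_(s in `[a, t]) g M s.
pose V t := fine (total_variation a t F).
have GE : (\int[mu]_(t in `[a, b]) (g M t)%:E)%E = (G b)%:E.
  rewrite /G /Rintegral fineK//.
  have : mu.-integrable `[a, b] (EFin \o g M) by exact: integrableS (ig M).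
  by apply: integrable_fin_num; exact: measurable_itv.
rewrite GE lee_fin -/(V b).
have Ga : G a = 0 by rewrite /G set_itv1 Rintegral_set1.
have Va : V a = 0 by rewrite /V total_variationxx.
suff : V a - G a <= V b - G b by lra.
apply: (@lower_dini_nondecreasing _ _ _ (fun t => V t - G t)) => //.
- exact: ltW.
(* [V] does not decrease, so a decrease of [V - G] is at most an increase of [G], whose slope is at
   most [M]. *)
- move=> e e0; have M0 : 0 < M%:R + 1 :> R by rewrite ltr_wpDl.
  exists (e / (M%:R + 1)); split; first exact: divr_gt0.
  move=> n x y fam; rewrite ltr_pdivlMr//; apply: le_lt_trans.
  rewrite mulr_suml; apply: ler_sum => i _.
  have [ax [xy yb]] := fam.1 i (ltn_ord i).
  have := primitive_le (ig M) ax xy (gM M); rewrite -/(G _) -/(G _).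
  have := abs_cont_TV_incr acF ax xy yb; rewrite -/(V _) -/(V _).
  have := normr_ge0 (F (y i) - F (x i)); rewrite -/(G _); nra.
- apply: ae_lebesgue_imply (ae_lebesgue_and ae_D (primitive_derivable a (ig M))).
  move=> t [hD hG] tab; have Dt := hD tab.
  have at_ : a < t by case: Dt => /=; rewrite in_itv/= => /andP[].
  have [dG G'] := hG at_; move=> e e0.
  (* One half of [e] is the error in the expansion of [F], which bounds the growth of [V] from
     below; the other half is the error in the expansion of [G]. *)
  have e2 : 0 < e / 2 by lra.
  have [r1 [r10 h1]] := derivable_expansion (dF Dt) e2.
  have [r2 [r20 h2]] := derivable_expansion dG e2.
  exists (Num.min r1 r2); split; first by rewrite lt_min r10.
  move=> s /andP[as_ sb]; rewrite lt_min => /andP[/h1{}h1 /h2{}h2].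
  have gt : g M t <= `|derive1 F t| by rewrite /g fE// ge_min lexx.
  rewrite -/mu -/(G s) -/(G t) G' in h2.
  move: tab => /andP[_ tb].
  have h3 : `|derive1 F t| * `|s - t| <= `|F s - F t| + e / 2 * `|s - t|.
    rewrite -normrM; have := ler_normB (F s - F t)
      (F s - F t - derive1 F t * (s - t)).
    rewrite opprB addrC subrK; lra.
  split=> ts.
    have := abs_cont_TV_incr acF (ltW at_) ts sb; rewrite -/(V _) -/(V _).
    move: h2 h3; rewrite (@ger0_norm _ (s - t)) ?subr_ge0// ler_norml.
    move=> /andP[_ h2]; nra.
  have := abs_cont_TV_incr acF as_ ts tb; rewrite -/(V _) -/(V _) distrC.
  move: h2 h3; rewrite (@ler0_norm _ (s - t)) ?subr_le0// ler_norml.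
  move=> /andP[h2 _]; nra.
Qed.

(** Monotone convergence: the truncations increase to [|f|] and their integrals stay below the total
    variation. *)
Let i_f : mu.-integrable setT (EFin \o f).
Proof.
apply/integrableP; split; first by apply/measurable_EFinP; exact: mf.
have lim_g t : ((g n t)%:E @[n --> \oo] --> `|f t|%:E)%E.
  apply/fine_cvgP; split; first exact: nearW.
  apply: cvg_near_cst; near=> n; rewrite /= /g; apply/min_idPl.
  by near: n; exact: nbhs_infty_ger.
have -> : (\int[mu]_t `|(EFin \o f) t| =
    \int[mu]_t limn (fun n => (g n t)%:E))%E.
  by apply: eq_integral => t _ /=; apply/esym/cvg_lim => //; exact: lim_g.
have -> : (\int[mu]_t limn (fun n => (g n t)%:E) =
    limn (fun n => \int[mu]_t (g n t)%:E))%E.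
  apply: monotone_convergence => //.
  - by move=> n; apply/measurable_EFinP; exact: mg.
  - by move=> n t _; rewrite lee_fin.
  - move=> t _ n m nm; rewrite lee_fin /g le_min !ge_min lexx/=.
    by rewrite ler_nat nm orbT.
apply: (@le_lt_trans _ _ (fine (total_variation a b F))%:E); last exact: ltry.
apply: lime_le; last by apply: nearW => n; exact: g_bound.
apply: ereal_nondecreasing_is_cvgn => n m nm.
apply: ge0_le_integral => //; try by move=> ? _; rewrite lee_fin.
- by apply/measurable_EFinP; exact: mg.
- by apply/measurable_EFinP; exact: mg.
- by move=> t _; rewrite lee_fin /g le_min !ge_min lexx/= ler_nat nm orbT.
Unshelve. all: by end_near. Qed.

Lemma integrable_derive1 : mu.-integrable D (EFin \o derive1 F).
Proof.
have : mu.-integrable D (EFin \o f) by exact: integrableS i_f.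
apply: eq_integrable => // t; rewrite inE => Dt.
by rewrite /= fE.
Qed.

Lemma integral_derive1 : (\int[mu]_(t in D) (derive1 F t)%:E = (F b - F a)%:E)%E.
Proof.
have -> : (\int[mu]_(t in D) (derive1 F t)%:E = \int[mu]_t (f t)%:E)%E.
  rewrite integral_mkcond; apply: eq_integral => t _.
  by rewrite /f !patchE; case: ifP.
rewrite int_ab; last exact: f0.
pose G t := \int[mu]_(s in `[a, t]) f s.
have -> : (\int[mu]_(t in `[a, b]) (f t)%:E)%E = (G b)%:E.
  rewrite /G /Rintegral fineK//.
  have : mu.-integrable `[a, b] (EFin \o f) by exact: integrableS i_f.
  by apply: integrable_fin_num; exact: measurable_itv.
have Ga : G a = 0 by rewrite /G set_itv1 Rintegral_set1.
have acG : abs_cont a b G by exact: primitive_abs_cont.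
(* [F - G] has derivative zero almost everywhere; [c = 1] and [c = -1] give the two inequalities. *)
have key c : c * F a - c * G a <= c * F b - c * G b.
  have := @abs_cont_nondecreasing _ a b (fun t => c * F t + (- c) * G t) (ltW ab).
  rewrite !mulNr; apply; first exact: abs_cont_lin.
  apply: ae_lebesgue_imply (ae_lebesgue_and ae_D (primitive_derivable a i_f)).
  move=> t [hD hG] tab; have Dt := hD tab.
  have at_ : a < t by case: Dt => /=; rewrite in_itv/= => /andP[].
  have [dG G'] := hG at_; have dFt := dF Dt.
  have dc : is_derive t 1 (fun t => c * F t + (- c) * G t)
     (c * derive1 F t + (- c) * derive1 G t).
    rewrite !derive1E; apply: is_deriveD; apply: is_deriveZ; exact: DeriveDef.
  split; first by case: dc.
  by rewrite derive1E; case: dc => _ ->; rewrite G' fE// mulNr subrr.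
by have := key 1; have := key (-1); rewrite Ga => h1 h2; congr EFin; lra.
Qed.
End FTC.

Lemma derive1_lin (R : realType) (c d : R) (f g : R -> R) (t : R) :
  derivable f t 1 -> derivable g t 1 ->
  derivable (fun s => c * f s + d * g s) t 1 /\
  derive1 (fun s => c * f s + d * g s) t = c * derive1 f t + d * derive1 g t.
Proof.
move=> df dg.
have dc : is_derive t 1 (fun s => c * f s + d * g s)
   (c * derive1 f t + d * derive1 g t).
  rewrite !derive1E; apply: is_deriveD; apply: is_deriveZ; exact: DeriveDef.
split; first by case: dc.
by rewrite derive1E; case: dc => _ ->.
Qed.

Lemma derive1_mul (R : realType) (f g : R -> R) (t : R) :
  derivable f t 1 -> derivable g t 1 ->
  derivable (fun s => f s * g s) t 1 /\
  derive1 (fun s => f s * g s) t = f t * derive1 g t + g t * derive1 f t.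
Proof.
move=> df dg.
have dc : is_derive t 1 (fun s => f s * g s)
   (f t * derive1 g t + g t * derive1 f t).
  rewrite !derive1E; apply: is_deriveM; exact: DeriveDef.
split; first by case: dc.
by rewrite derive1E; case: dc => _ ->.
Qed.

Lemma ae_itv (R : realType) (a b : R) (P : R -> Prop) :
  {ae (@lebesgue_measure R), forall t, a < t < b -> P t} ->
  {ae (@lebesgue_measure R), forall t, a <= t <= b -> P t}.
Proof.
have ae1 c : {ae (@lebesgue_measure R), forall t : R, t <> c}.
  exists [set c]; split; [by []|exact: lebesgue_measure_set1|].
  by move=> t /= /contrapT.
move=> hP; apply: ae_lebesgue_imply (ae_lebesgue_and hP (ae_lebesgue_and (ae1 a) (ae1 b))).
move=> t [h [/eqP ta /eqP tb]] /andP[at_ tb']; apply: h.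
by rewrite !lt_neqAle at_ tb' tb eq_sym ta.
Qed.

(** Replaces an almost everywhere statement by one valid at every point of a measurable domain over
    which all integrals are unchanged. *)
Lemma ae_integral_dom (R : realType) (a b : R) (P : R -> Prop) : a < b ->
  {ae (@lebesgue_measure R), forall t, a <= t <= b -> P t} ->
  exists N : set R, [/\ measurable N, (@lebesgue_measure R) N = 0%E,
    forall t, (`]a, b[%classic `\` N) t -> P t &
    forall f : R -> \bar R, (\int[@lebesgue_measure R]_(t in [set t | (a <= t <= b)%R]) f t =
      \int[@lebesgue_measure R]_(t in `]a, b[%classic `\` N) f t)%E].
Proof.
move=> ab /ae_lebesgueP[N [mN N0 NP]]; exists N; split=> //.
  move=> t [/=]; rewrite in_itv/= => /andP[at_ tb] nN.
  by apply: contrapT => h; apply: nN; apply: NP => h'; apply: h; apply: h'; rewrite !ltW.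
move=> f; have mU : measurable (N `|` [set a; b]).
  by apply: measurableU => //; exact: measurableU.
have U0 : (@lebesgue_measure R) (N `|` [set a; b]) = 0%E.
  have h2 : (@lebesgue_measure R) [set a; b] = 0%E.
    rewrite -(lebesgue_measure_set1 a); apply: measureU0 => //.
    exact: lebesgue_measure_set1.
  by rewrite -N0; apply: measureU0 => //; exact: measurableU.
transitivity (\int[@lebesgue_measure R]_(t in [set t | (a <= t <= b)%R] `\` (N `|` [set a; b])) f t)%E.
  by apply: integral_setD_null; [exact: mU|exact: U0].
congr (integral _ _ _); apply/seteqP; split => t /=; rewrite in_itv/=.
  move=> [/andP[at_ tb] /not_orP[nN /not_orP[ta tb']]]; split=> //.
  by rewrite !lt_neqAle at_ tb !andbT; apply/andP; split; apply/eqP => // /esym.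
move=> [/andP[at_ tb] nN]; split; first by rewrite !ltW.
by move=> [//|[tE|tE]]; move: at_ tb; rewrite tE ltxx.
Qed.

Lemma ae_integral_derive1 (R : realType) (a b : R) (F f : R -> R) : a < b ->
  abs_cont a b F ->
  {ae (@lebesgue_measure R), forall t, a <= t <= b ->
    derivable F t 1 /\ f t = derive1 F t} ->
  (\int[@lebesgue_measure R]_(t in [set t | (a <= t <= b)%R]) (f t)%:E =
    (F b - F a)%:E)%E.
Proof.
move=> ab acF /(ae_integral_dom ab)[N [mN N0 ND ->]].
rewrite -(integral_derive1 ab acF mN N0) => [|t /ND[]//].
by apply: eq_integral => t; rewrite inE => /ND[_ ->].
Qed.

Lemma abs_cont_cst (R : realType) (T : R) (f : R -> R) : abs_cont 0 T f ->
  {ae (@lebesgue_measure R), forall t, 0 <= t <= T ->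
    derivable f t 1 /\ derive1 f t = 0} ->
  forall t, 0 <= t <= T -> f t = f 0.
Proof.
move=> acf f0 t /andP[t0 tT].
have key c : c * f 0 + 0 * f 0 <= c * f t + 0 * f t.
  apply: (@abs_cont_nondecreasing _ 0 t (fun t => c * f t + 0 * f t)) => //.
    by apply: abs_cont_lin; exact: abs_contS acf.
  apply: ae_lebesgue_imply f0 => s hs /andP[s0 st].
  have [|df f'0] := hs; first by rewrite s0 (le_trans st).
  by have [d1 ->] := derive1_lin c 0 df df; rewrite f'0 !mulr0 addr0.
by have := key 1; have := key (-1); lra.
Qed.

(** A nondecreasing function with equal end values is constant, so its derivative vanishes at
    interior times. *)
Lemma abs_cont_closed_monotone (R : realType) (T : R) (f : R -> R) :
  abs_cont 0 T f -> f T = f 0 ->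
  {ae (@lebesgue_measure R), forall t, 0 <= t <= T ->
    derivable f t 1 /\ 0 <= derive1 f t} ->
  {ae (@lebesgue_measure R), forall t, 0 <= t <= T -> derive1 f t = 0}.
Proof.
move=> acf fT f0; apply: ae_itv.
have cst t : 0 <= t <= T -> f t = f 0.
  move=> /andP[t0 tT]; apply/eqP; rewrite eq_le; apply/andP; split.
    rewrite -fT; apply: abs_cont_nondecreasing => //; first exact: abs_contS acf.
    by apply: ae_lebesgue_imply f0 => s hs /andP[ts sT]; apply: hs; rewrite (le_trans t0).
  apply: abs_cont_nondecreasing => //; first exact: abs_contS acf.
  by apply: ae_lebesgue_imply f0 => s hs /andP[s0 st]; apply: hs; rewrite s0 (le_trans st).
apply: ae_lebesgue_imply f0 => t _ /andP[t0 tT].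
rewrite -(derive1_cst (f 0) t) !derive1E; apply: near_eq_derive => //.
near=> s; apply: cst; apply/andP; split; apply/ltW.
  by near: s; exact: lt_nbhsr.
by near: s; exact: lt_nbhsl.
Unshelve. all: by end_near. Qed.

(** The product of the closed curve with [v] is nondecreasing, hence constant; this rules out the
    second alternative almost everywhere. *)
Lemma closed_curve_cst (R : realType) (T : R) (w : R -> R * R) (v : R * R) :
  abs_cont 0 T (fun s => (w s).1) -> abs_cont 0 T (fun s => (w s).2) ->
  w T = w 0 ->
  {ae (@lebesgue_measure R), forall t, 0 <= t <= T -> derivable2 w t /\
    (dvec w t = (0, 0) \/ 0 < dot (dvec w t) v)} ->
  forall t, 0 <= t <= T -> w t = w 0.
Proof.
move=> ac1 ac2 wT wv.
have h0 : {ae (@lebesgue_measure R), forall t, 0 <= t <= T ->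
    derive1 (fun s => v.1 * (w s).1 + v.2 * (w s).2) t = 0}.
  apply: abs_cont_closed_monotone; [exact: abs_cont_lin|by rewrite wT|].
  apply: ae_lebesgue_imply wv => t h /h[[d1 d2] hd].
  have [d ->] := derive1_lin v.1 v.2 d1 d2; split=> //.
  move: hd; rewrite /dvec /dot/= => -[[-> ->]|]; first by rewrite !mulr0 addr0.
  by rewrite mulrC [X in _ + X]mulrC => /ltW.
have w0 : {ae (@lebesgue_measure R), forall t, 0 <= t <= T ->
    derivable2 w t /\ dvec w t = (0, 0)}.
  apply: ae_lebesgue_imply (ae_lebesgue_and h0 wv) => t [e0 hw] tT.
  have [[d1 d2] [|]] := hw tT; first by [].
  have := e0 tT; have [_ ->] := derive1_lin v.1 v.2 d1 d2; rewrite /dvec /dot/=.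
  by rewrite mulrC [X in _ + X]mulrC => ->; rewrite ltxx.
move=> t tT.
have -> : w t = ((w t).1, (w t).2) by case: (w t).
rewrite (abs_cont_cst ac1 _ tT); last first.
  by apply: ae_lebesgue_imply w0 => s h /h[[d1 _]]; rewrite /dvec => -[].
rewrite (abs_cont_cst ac2 _ tT); first by case: (w 0).
by apply: ae_lebesgue_imply w0 => s h /h[[_ d2]]; rewrite /dvec => -[].
Qed.

(** * Action and length *)

Lemma abs_cont_measurable (R : realType) (a b : R) (f : R -> R) (D : set R) :
  a <= b -> abs_cont a b f -> (forall t, D t -> a <= t <= b) -> measurable D ->
  measurable_fun D f.
Proof.
move=> ab acf Dab mD.
have mfc : measurable_fun setT (fun t => f (clamp a b t)).
  by apply: continuous_measurable_fun; exact: abs_cont_clamp_continuous.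
apply: (@eq_measurable_fun _ _ _ _ D (fun t => f (clamp a b t))).
  by move=> t; rewrite inE => /Dab tab; rewrite clamp_id.
exact: measurable_funTS.
Qed.

Lemma integrable_abs_contM (R : realType) (a b : R) (f h : R -> R) (D : set R) :
  a <= b -> abs_cont a b f -> (forall t, D t -> a <= t <= b) -> measurable D ->
  (@lebesgue_measure R).-integrable D (EFin \o h) ->
  (@lebesgue_measure R).-integrable D (EFin \o (fun t => f t * h t)).
Proof.
move=> ab acf Dab mD ih; have [M fM] := abs_cont_bounded ab acf.
have mh : measurable_fun D h.
  by apply/measurable_EFinP; exact: measurable_int ih.
apply: (@le_integrable _ _ _ lebesgue_measure D mD _
  (fun t => M%:E * (EFin \o h) t)%E).
- apply/measurable_EFinP; apply: measurable_funM => //.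
  exact: abs_cont_measurable ab acf Dab mD.
- move=> t Dt; rewrite /= lee_fin !normrM ler_wpM2r//.
  by apply: le_trans (fM t (Dab t Dt)) _; exact: ler_norm.
- exact: integrableZl.
Qed.

(** Integration by parts around the closed curve turns the action into the integral of <p, q'>. Its
    primitive [P] grows at least as fast as <q, y> for every [y] in [Q]; taking [y] optimal for a
    chord bounds the length of the chord by an increment of [P]. *)
Lemma action_partition (R : realType) (K Q : set (R * R)) (T : R)
    (q p : R -> R * R) : compact Q -> gen_char K Q T q p ->
  exists A, action T q p = A%:E /\ partition_bound Q T A q.
Proof.
move=> cQ [T0 [q1 [q2 [p1 [p2 [qT [pT [hKQ [_ ae_q]]]]]]]]].
have [N [mN N0 ND intN]] := ae_integral_dom T0 ae_q.
set D := `]0, T[%classic `\` N in ND intN.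
have mD : measurable D by exact: measurable_dom.
have DT t : D t -> 0 <= t <= T.
  by move=> [/=]; rewrite in_itv/= => /andP[? ?] _; rewrite !ltW.
have T0' := ltW T0.
pose mu := @lebesgue_measure R.
pose phi t := (p t).1 * derive1 (fun s => (q s).1) t +
              (p t).2 * derive1 (fun s => (q s).2) t.
have i_phi : mu.-integrable D (EFin \o phi).
  have h1 : mu.-integrable D (EFin \o (fun t => (p t).1 * derive1 (fun s => (q s).1) t)).
    apply: (integrable_abs_contM T0' p1 DT mD).
    by apply: (integrable_derive1 T0 q1 mN N0) => t /ND[[]].
  have h2 : mu.-integrable D (EFin \o (fun t => (p t).2 * derive1 (fun s => (q s).2) t)).
    apply: (integrable_abs_contM T0' p2 DT mD).
    by apply: (integrable_derive1 T0 q2 mN N0) => t /ND[[]].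
  exact: integrableD h1 h2.
(* The product <q, p>; the factors [1] give it the shape of [abs_cont_lin] and [derive1_lin]. *)
pose m t := 1 * ((q t).1 * (p t).1) + 1 * ((q t).2 * (p t).2).
have acm : abs_cont 0 T m by apply: abs_cont_lin; exact: abs_contM.
have dm t : D t -> derivable m t 1 /\ derive1 m t =
    1 * ((q t).1 * derive1 (fun s => (p s).1) t + (p t).1 * derive1 (fun s => (q s).1) t) +
    1 * ((q t).2 * derive1 (fun s => (p s).2) t + (p t).2 * derive1 (fun s => (q s).2) t).
  move=> /ND[[dq1 dq2] [[dp1 dp2] _]].
  have [d1 e1] := derive1_mul dq1 dp1; have [d2 e2] := derive1_mul dq2 dp2.
  by have [d ->] := derive1_lin 1 1 d1 d2; rewrite e1 e2.
pose phiD : R -> R := phi \_ D.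
have i_phiD : mu.-integrable setT (EFin \o phiD).
  rewrite /phiD -restrict_EFin; apply/integrable_restrict => //.
  by rewrite setTI.
pose P t := \int[mu]_(s in `[0, t]) phiD s.
have PT : (\int[mu]_(t in D) (phi t)%:E)%E = (P T)%:E.
  have -> : (\int[mu]_(t in D) (phi t)%:E = \int[mu]_(t in `[0%R, T]) (phiD t)%:E)%E.
    rewrite [LHS]integral_mkcond [RHS]integral_mkcond; apply: eq_integral => t _.
    rewrite /phiD !patchE; case: ifPn => [|_]; last by case: ifP.
    by rewrite inE => /DT tT; rewrite mem_set//= in_itv.
  rewrite /P /Rintegral fineK//.
  have : mu.-integrable `[0, T] (EFin \o phiD) by exact: integrableS i_phiD.
  by apply: integrable_fin_num; exact: measurable_itv.
exists (P T); split.
  rewrite /action intN.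
  have -> : (\int[mu]_(t in D) (dot (p t) (dvec q t) - dot (q t) (dvec p t))%:E =
      \int[mu]_(t in D) ((2 * phi t)%:E - (derive1 m t)%:E))%E.
    apply: eq_integral => t; rewrite inE => /dm[_ ->].
    by rewrite -EFinB; congr EFin; rewrite /phi /dot /dvec/=; ring.
  have i2 : mu.-integrable D (fun t => (2 * phi t)%:E).
    have -> : (fun t => (2 * phi t)%:E) = (fun t => 2%:E * (EFin \o phi) t)%E by [].
    exact: integrableZl.
  have im : mu.-integrable D (EFin \o derive1 m).
    by apply: (integrable_derive1 T0 acm mN N0) => t /dm[].
  rewrite integralB_EFin//.
  have -> : (\int[mu]_(t in D) (derive1 m t)%:E = 0)%E.
    have -> := integral_derive1 T0 acm mN N0 (fun t Dt => (dm t Dt).1).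
    by rewrite /m qT pT subrr.
  rewrite sube0.
  have -> : (\int[mu]_(t in D) (2 * phi t)%:E = 2%:E * \int[mu]_(t in D) (phi t)%:E)%E.
    rewrite -integralZl//.
  by rewrite PT -!EFinM; congr EFin; field.
have incr y u v : Q y -> 0 <= u -> u <= v -> v <= T ->
    dot (vsub (q v) (q u)) y <= P v - P u.
  move=> Qy u0 uv vT.
  (* Its derivative is <p - y, q'>, nonnegative because q' is normal to [Q] at p. *)
  pose h t := 1 * P t + (-1) * (y.1 * (q t).1 + y.2 * (q t).2).
  have : h u <= h v.
    apply: abs_cont_nondecreasing => //.
      apply: (@abs_contS _ 0 T) => //; apply: abs_cont_lin.
        exact: primitive_abs_cont.
      exact: abs_cont_lin.
    have aeD := ae_lebesgue_and ae_q (primitive_derivable 0 i_phiD).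
    have aeN : {ae mu, forall t, ~ N t}.
      by exists N; split=> // t /= /contrapT.
    apply: ae_itv; apply: ae_lebesgue_imply (ae_lebesgue_and aeN aeD).
    move=> t [nN [hq hP]] /andP[ut tv].
    have t0 : 0 < t by apply: le_lt_trans ut.
    have tT : t < T by apply: lt_le_trans vT.
    have Dt : D t by split=> //=; rewrite in_itv/= t0.
    have [dP P'] := hP t0.
    have [[dq1 dq2] [_ [nq [np [_ [hnp [dvq _]]]]]]] := ND t Dt.
    have [d1 e1] := derive1_lin y.1 y.2 dq1 dq2.
    have [d2 e2] := derive1_lin 1 (-1) dP d1.
    split=> //; rewrite e2 P' e1 /phiD patchE mem_set// /phi.
    have := hnp y Qy; rewrite -dvq /dvec /dot /vsub/=; lra.
  rewrite /h /dot /vsub/=; lra.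
move=> n t t0 tn tmono.
have mono i j : (i <= j)%N -> (j <= n)%N -> t i <= t j.
  elim: j => [|j IH]; first by rewrite leqn0 => /eqP ->.
  rewrite leq_eqVlt => /predU1P[->//|]; rewrite ltnS => ij jn.
  exact: le_trans (IH ij (ltnW jn)) (tmono j jn).
have P0 : P 0 = 0 by rewrite /P set_itv1 Rintegral_set1.
apply: (@le_trans _ _ (\sum_(i < n) (P (t i.+1) - P (t i)))).
  apply: ler_sum => i _; have iN := ltn_ord i.
  have [|y [Qy ->]] := hQ_att (vsub (q (t i.+1)) (q (t i))) cQ.
    by exists (p 0); have [|_ []] := hKQ 0; rewrite ?lexx.
  apply: incr => //.
  - by rewrite -t0; apply: mono => //; exact: ltnW.
  - exact: tmono.
  - by rewrite -tn; apply: mono.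
rewrite -(big_mkord xpredT (fun i => P (t i.+1) - P (t i))) telescope_sumr//.
by rewrite t0 tn P0 subr0.
Qed.

(** * The lower bound for the capacity *)

(** A nonzero normal pairs strictly negatively with the direction to an interior point. Once [p] is
    constant, the velocities of [q] are normals at the single point [p 0], so each of them vanishes
    or pairs positively with [p 0 - y0], and the closed curve [q] is constant too. *)
Lemma gen_char_not_interior (R : realType) (K Q : set (R * R)) (T : R)
    (q p : R -> R * R) (t : R * R) : compact K -> compact Q ->
  interior Q !=set0 -> gen_char K Q T q p ->
  ~ (forall u, 0 <= u <= T -> interior K (vadd (q u) t)).
Proof.
move=> cK cQ [y0 Qy0] [T0 [q1 [q2 [p1 [p2 [qT [pT [hKQ [[u [uT nc]] ae_q]]]]]]]]] hK.
have neg (A : set (R * R)) (z n w : R * R) : compact A -> interior A w -> normal_cone A z n -> A z ->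
    n = (0, 0) \/ dot n (vsub w z) < 0.
  move=> cA Aw An Az; have [->|n0] := pselect (n = (0, 0)); [by left|right].
  have wn := dot_interior_lt cA Aw n0.
  suff : hQ A n <= dot n z by move: wn; rewrite /dot /vsub/=; lra.
  have [|y [Ay ->]] := hQ_att n cA; first by exists z.
  by have := An y Ay; rewrite /dot /vsub/=; lra.
have pc : forall s, 0 <= s <= T -> p s = p 0.
  apply: (@closed_curve_cst _ _ _ t) => //.
  apply: ae_lebesgue_imply ae_q => s hs sT.
  have [dq [dp [nq [np [hnq [_ [_ ->]]]]]]] := hs sT; split=> //.
  have [Kq _] := hKQ s sT.
  have [->|h] := neg _ _ _ _ cK (hK s sT) hnq Kq; [left|right].
    by rewrite /= oppr0.
  by move: h; rewrite /dot /vadd /vsub/=; lra.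
have qc : forall s, 0 <= s <= T -> q s = q 0.
  apply: (@closed_curve_cst _ _ _ (vsub (p 0) y0)) => //.
  apply: ae_lebesgue_imply ae_q => s hs sT.
  have [dq [dp [nq [np [_ [hnp [-> _]]]]]]] := hs sT; split=> //.
  have [_ [Qp _]] := hKQ s sT.
  have [->|h] := neg _ _ _ _ cQ Qy0 hnp Qp; [by left|right].
  by move: h; rewrite (pc s sT) /dot /vsub/=; lra.
by case: nc; [rewrite qc|rewrite pc].
Qed.

(** A box of radius [r] around [k0] shrinks to a box of radius [(1 - a) * r] around the new
    point. *)
Lemma scaled_interior (R : realType) (K : set (R * R)) (a : R) z k0 :
  Defs.convex_set K -> K z -> interior K k0 -> 0 <= a -> a < 1 ->
  interior K (vadd (vscale a z) (vscale (1 - a) k0)).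
Proof.
move=> cvK Kz /interior_box[r [r0 hr]] a0 a1.
have a1' : 0 < 1 - a by rewrite subr_gt0.
apply: (@box_interior _ _ _ ((1 - a) * r)); first exact: mulr_gt0.
move=> u v ur vr.
have hu w : `|w| <= (1 - a) * r -> `|w / (1 - a)| <= r.
  by rewrite normrM normfV (gtr0_norm a1') ler_pdivrMr// mulrC.
have := cvK _ _ Kz (hr _ _ (hu _ ur) (hu _ vr)) a; rewrite a0 (ltW a1) => /(_ isT).
congr K; rewrite /vadd /vscale/=; congr pair; field; lra.
Qed.

Lemma capacity_ge1 (R : realType) n0 (s : 'I_n0 -> R * R) (K : set (R * R))
    (Q := conv_hull s) : interior Q !=set0 -> convex_shape K ->
  (forall T, Qnormal_triangle Q T -> fits T K) -> (1%:E <= capacity K Q)%E.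
Proof.
move=> Q0 [cK [cvK [k0 Kk0]]] QK.
have cQ : compact Q by exact: conv_hull_compact.
apply: le_ereal_inf_tmp => _ [T [q [p [gc ->]]]].
have [A [-> pb]] := action_partition cQ gc.
rewrite lee_fin leNgt; apply/negP => A1.
have [T0 [_ [_ [_ [_ [qT [_ [hKQ _]]]]]]]] := gc.
have A0 : 0 <= A.
  (* The one-step partition of a closed curve has length zero. *)
  have := pb 1%N (fun i => if i == 0%N then 0 else T) erefl erefl.
  rewrite big_ord1/= -qT (_ : vsub (q 0) (q 0) = (0, 0)); last first.
    by rewrite /vsub !subrr.
  rewrite hQ0//; last by have [y /interior_subset] := Q0; exists y.
  by apply=> -[|i] //= _; exact: ltW T0.
have [t ht] := curve_fits Q0 cK cvK (interior_subset Kk0) QK (ltW T0) (esym qT) pb.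
apply: (gen_char_not_interior (t := t) cK cQ Q0 gc) => u uT.
by have [z [Kz ->]] := ht u uT; exact: scaled_interior.
Qed.

Lemma unit_curve_fits (R : realType) n0 (s : 'I_n0 -> R * R) (K : set (R * R))
    (Q := conv_hull s) (g : R -> R * R) : interior Q !=set0 -> convex_shape K ->
  (forall T, Qnormal_triangle Q T -> fits T K) -> closed_curve g ->
  Qlength Q g = 1%:E -> fits (curve_image g) K.
Proof.
move=> Q0 [cK [cvK [k0 /interior_subset Kk0]]] QK [_ g01] gl.
have pb : partition_bound Q 1 1 g.
  move=> n t t0 t1 tm; rewrite -lee_fin -gl; apply: ereal_sup_ubound.
  by exists n, t.
have [t ht] := curve_fits Q0 cK cvK Kk0 QK ler01 (esym g01) pb.
exists t => _ [u /= + <-]; rewrite in_itv/= => /ht[z [Kz ->]].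
suff -> : vadd (vscale 1 z) (vscale (1 - 1) k0) = z by [].
by case: z {Kz} => z1 z2; rewrite /vadd /vscale/=; congr pair; ring.
Qed.

(** * Existence of short billiard trajectories *)

Section polar_duality.
Variable R : realType.
Local Notation V := ((R * R) * (R * R))%type.

Definition dot4 (x y : V) : R := dot x.1 y.1 + dot x.2 y.2.

Definition convex4 (C : set V) := forall x y, C x -> C y ->
  forall t : R, 0 <= t <= 1 ->
  C (vadd (vscale t x.1) (vscale (1 - t) y.1),
     vadd (vscale t x.2) (vscale (1 - t) y.2)).

Definition polar (C : set V) : set V :=
  [set x | forall y, C y -> dot4 x y <= 1].

Lemma cvg_fst_comp (T U1 U2 : topologicalType) (f : T -> U1 * U2) (x : T) (l : U1 * U2) :
  f y @[y --> x] --> l -> (f y).1 @[y --> x] --> l.1.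
Proof. by move=> h; exact: cvg_comp h cvg_fst. Qed.

Lemma cvg_snd_comp (T U1 U2 : topologicalType) (f : T -> U1 * U2) (x : T) (l : U1 * U2) :
  f y @[y --> x] --> l -> (f y).2 @[y --> x] --> l.2.
Proof. by move=> h; exact: cvg_comp h cvg_snd. Qed.

Lemma cvg_dot (T : topologicalType) (f g : T -> R * R) (x : T) (l m : R * R) :
  f y @[y --> x] --> l -> g y @[y --> x] --> m ->
  dot (f y) (g y) @[y --> x] --> dot l m.
Proof.
move=> hf hg.
apply: (cvgD (cvgM (cvg_fst_comp hf) (cvg_fst_comp hg))
             (cvgM (cvg_snd_comp hf) (cvg_snd_comp hg))).
Qed.

Lemma cvg_dot4 (T : topologicalType) (f g : T -> V) (x : T) (l m : V) :
  f y @[y --> x] --> l -> g y @[y --> x] --> m ->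
  dot4 (f y) (g y) @[y --> x] --> dot4 l m.
Proof.
move=> hf hg.
exact: (cvgD (cvg_dot (cvg_fst_comp hf) (cvg_fst_comp hg))
             (cvg_dot (cvg_snd_comp hf) (cvg_snd_comp hg))).
Qed.

Lemma cvg_vsub (T : topologicalType) (f g : T -> R * R) (x : T) (l m : R * R) :
  f y @[y --> x] --> l -> g y @[y --> x] --> m ->
  vsub (f y) (g y) @[y --> x] --> vsub l m.
Proof.
move=> hf hg.
exact: (cvg_pair (cvgB (cvg_fst_comp hf) (cvg_fst_comp hg))
                 (cvgB (cvg_snd_comp hf) (cvg_snd_comp hg))).
Qed.

(* The nearest point of [C] to [w] gives the separating hyperplane. *)
Lemma separation4 (C : set V) w : compact C -> convex4 C -> C !=set0 -> ~ C w ->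
  exists n r, (forall c, C c -> dot4 n c <= r) /\ r < dot4 n w.
Proof.
move=> cC cvC C0 Cw.
pose sub4 (x y : V) : V := (vsub x.1 y.1, vsub x.2 y.2).
have [|c0 + hc] := @compact_EVT_min _ _ (fun c => dot4 (sub4 w c) (sub4 w c)) C C0 cC.
  apply: continuous_subspaceT => c.
  have hs : sub4 w y @[y --> c] --> sub4 w c.
    have hid : y @[y --> c] --> c by exact: cvg_id.
    exact: cvg_pair (cvg_vsub (cvg_cst _) (cvg_fst_comp hid))
      (cvg_vsub (cvg_cst _) (cvg_snd_comp hid)).
  exact: cvg_dot4.
rewrite inE => Cc0; pose n := sub4 w c0; exists n, (dot4 n c0); split; last first.
  rewrite -subr_gt0.
  have -> : dot4 n w - dot4 n c0 = dot4 n n.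
    by rewrite /dot4 /dot /n /sub4 /vsub/=; ring.
  rewrite lt_neqAle; apply/andP; split; last first.
    by rewrite /dot4 /dot -!expr2 !addr_ge0// sqr_ge0.
  apply/negP => /eqP/esym/eqP.
  rewrite /dot4 /dot -!expr2 paddr_eq0 ?addr_ge0 ?sqr_ge0//.
  rewrite !paddr_eq0 ?sqr_ge0// !sqrf_eq0 !subr_eq0.
  move=> /andP[/andP[/eqP h1 /eqP h2] /andP[/eqP h3 /eqP h4]]; apply: Cw.
  by case: w c0 h1 h2 h3 h4 Cc0 {hc n} => [[? ?] [? ?]] [[? ?] [? ?]] /= -> -> -> ->.
move=> c Cc; rewrite -subr_le0.
pose d := sub4 c c0.
have -> : dot4 n c - dot4 n c0 = dot4 n d.
  by rewrite /dot4 /dot /d /sub4 /vsub/=; ring.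
have dd0 : 0 <= dot4 d d by rewrite /dot4 /dot -!expr2 !addr_ge0// sqr_ge0.
(* Minimality of the distance at [c0], tested at the point of parameter [t] on the segment from [c0]
   to [c]. *)
have key t : 0 <= t <= 1 -> 0 < t -> 2 * dot4 n d <= t * dot4 d d.
  move=> t01 t0; have := hc _ (mem_set (cvC _ _ Cc Cc0 t t01)).
  have -> : dot4 (sub4 w (vadd (vscale t c.1) (vscale (1 - t) c0.1),
                          vadd (vscale t c.2) (vscale (1 - t) c0.2)))
                 (sub4 w (vadd (vscale t c.1) (vscale (1 - t) c0.1),
                          vadd (vscale t c.2) (vscale (1 - t) c0.2))) =
      dot4 n n + t * (t * dot4 d d - 2 * dot4 n d).
    by rewrite /dot4 /dot /n /d /sub4 /vsub /vadd /vscale/=; ring.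
  by rewrite -/n lerDl pmulr_rge0// subr_ge0.
rewrite leNgt; apply/negP => nd0.
have h1 := key 1; rewrite ler01 lexx ltr01 mul1r in h1.
have {}h1 := h1 isT isT.
have ddp : 0 < dot4 d d by lra.
(* The parameter of the projection of [w] on that segment; the case [t = 1] has shown that it is at
   most 1/2. *)
have := key (dot4 n d / dot4 d d); rewrite divr_gt0// divfK ?gt_eqF//.
rewrite ler_pdivrMr// mul1r => h2.
have : 2 * dot4 n d <= dot4 n d.
  by apply: h2 => //; rewrite ltW ?divr_gt0//=; lra.
lra.
Qed.

Lemma bipolar (C : set V) w : compact C -> convex4 C -> C ((0, 0), (0, 0)) ->
  (forall x, polar C x -> dot4 x w <= 1) -> C w.
Proof.
move=> cC cvC C0 hw; apply: contrapT => Cw.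
have [|n [r [nC rw]]] := separation4 cC cvC _ Cw; first by exists ((0, 0), (0, 0)).
have r0 : 0 <= r by apply: le_trans (nC _ C0); rewrite /dot4 /dot/= !mulr0 !addr0.
(* A level strictly between [r] and [dot4 n w], hence positive even if [r = 0]; [n / b] is in the
   polar and exceeds 1 at [w]. *)
pose b := (r + dot4 n w) / 2.
have b0 : 0 < b by rewrite /b; lra.
have E y : dot4 (vscale b^-1 n.1, vscale b^-1 n.2) y = dot4 n y / b.
  by rewrite /dot4 /dot /vscale/=; ring.
have := hw (vscale b^-1 n.1, vscale b^-1 n.2); rewrite E ler_pdivrMr// mul1r => h.
have : dot4 n w <= b.
  apply: h => y Cy; rewrite E ler_pdivrMr// mul1r.
  by apply: le_trans (nC _ Cy) _; rewrite /b; lra.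
by rewrite /b; lra.
Qed.

(** The points of [C] at distance [r] along the coordinate axes bound every coordinate of a polar
    vector by [r^-1]. *)
Lemma polar_compact (C : set V) r : 0 < r ->
  (forall u v, `|u| <= r -> `|v| <= r ->
    C ((u, v), (0, 0)) /\ C ((0, 0), (u, v))) -> compact (polar C).
Proof.
move=> r0 hC; pose I := `[(- r^-1), r^-1]%classic : set R.
apply: (@subclosed_compact _ _ ((I `*` I) `*` (I `*` I))).
- have -> : polar C = \bigcap_(y in C) [set x | dot4 x y <= 1].
    by apply/seteqP; split => x h y; exact: h.
  apply: closed_bigI => y _.
  have cy : continuous (dot4 ^~ y).
    by move=> x; apply: cvg_dot4; [exact: cvg_id|exact: cvg_cst].
  have -> : [set x | dot4 x y <= 1] = (dot4 ^~ y) @^-1` [set t : R | t <= 1] by [].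
  by have /continuous_closedP := cy; apply; exact: closed_le.
- by do !apply: compact_setX; exact: segment_compact.
move=> [[x1 x2] [x3 x4]] hx.
have r1 : `|r| <= r by rewrite gtr0_norm.
have r2 : `|- r| <= r by rewrite normrN gtr0_norm.
have r3 : `|0 : R| <= r by rewrite normr0 ltW.
have bnd x : x * r <= 1 -> x * (- r) <= 1 -> I x.
  move=> h1 h2; rewrite /I/= in_itv/= lerNl.
  by rewrite -[r^-1]div1r !ler_pdivlMr//; lra.
have h u v (hu : `|u| <= r) (hv : `|v| <= r) := (hx _ (hC u v hu hv).1, hx _ (hC u v hu hv).2).
have [a1 a2] := h _ _ r1 r3; have [a3 a4] := h _ _ r2 r3.
have [a5 a6] := h _ _ r3 r1; have [a7 a8] := h _ _ r3 r2.
rewrite /dot4 /dot/= in a1 a2 a3 a4 a5 a6 a7 a8.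
by do !split; apply: bnd => /=; lra.
Qed.

(* [c] is the maximum of the pairing over the two polars, attained at
   [(x, n)]; by the bipolar theorem [x / c] and [n / c] lie in [A] and [B]. *)
Lemma polar_critical_pair (A B : set V) z :
  compact A -> convex4 A -> A ((0, 0), (0, 0)) -> compact (polar A) ->
  compact B -> convex4 B -> B ((0, 0), (0, 0)) -> compact (polar B) ->
  polar B z -> ~ A z ->
  exists a b, [/\ A a, B b, 0 < dot4 a b, dot4 a b < 1 &
    (forall b', B b' -> dot4 a b' <= dot4 a b) /\
    (forall a', A a' -> dot4 a' b <= dot4 a b)].
Proof.
move=> cA cvA A0 cpA cB cvB B0 cpB Bz Az.
have P0 C : polar C ((0, 0), (0, 0)).
  by move=> y _; rewrite /dot4 /dot/= !mul0r !addr0.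
have [||[x n] + hmax] := @compact_EVT_max _ _
    (fun w : V * V => dot4 w.1 w.2) (polar B `*` polar A) _ (compact_setX cpB cpA).
- by exists (((0, 0), (0, 0)), ((0, 0), (0, 0))).
- apply: continuous_subspaceT => w.
  have hid : y @[y --> w] --> w by exact: cvg_id.
  exact: cvg_dot4 (cvg_fst_comp hid) (cvg_snd_comp hid).
rewrite inE/= => -[Bx An]; set c := dot4 x n.
have {}hmax x' n' : polar B x' -> polar A n' -> dot4 x' n' <= c.
  by move=> h1 h2; apply: (hmax (x', n')); rewrite inE.
(* Otherwise [z] would pair to at most 1 with all of [polar A] and lie in [A] by bipolarity. *)
have c1 : 1 < c.
  rewrite ltNge; apply/negP => c1; apply: Az; apply: bipolar => // y Ay.
  apply: le_trans c1; have -> : dot4 y z = dot4 z y by rewrite /dot4 /dot; ring.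
  exact: hmax.
have c0 : 0 < c by rewrite (lt_trans ltr01).
pose sc (y : V) : V := (vscale c^-1 y.1, vscale c^-1 y.2).
have scl y y' : dot4 (sc y) y' = dot4 y y' / c by rewrite /dot4 /dot /vscale/=; ring.
have scr y y' : dot4 y (sc y') = dot4 y y' / c by rewrite /dot4 /dot /vscale/=; ring.
have dC y y' : dot4 y y' = dot4 y' y by rewrite /dot4 /dot; ring.
have ab : dot4 (sc x) (sc n) = c^-1.
  by rewrite scl scr -/c divff ?gt_eqF// mul1r.
exists (sc x), (sc n); rewrite ab invr_gt0 invf_lt1//; split=> //.
- apply: bipolar => // y Ay; rewrite scr ler_pdivrMr// mul1r dC; exact: hmax.
- apply: bipolar => // y By; rewrite scr ler_pdivrMr// mul1r; exact: hmax.
split=> [b Bb|a Aa].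
  by rewrite scl -[leRHS]mul1r ler_wpM2r ?invr_ge0 ?(ltW c0)//; exact: Bx.
by rewrite scr -[leRHS]mul1r ler_wpM2r ?invr_ge0 ?(ltW c0)// dC; exact: An.
Qed.
End polar_duality.

(** * Piecewise linear paths *)

Lemma ae_not_nat (R : realType) :
  {ae (@lebesgue_measure R), forall t, forall k : nat, t <> k%:R}.
Proof.
have cN : countable (range (fun k : nat => k%:R : R)).
  by apply: sub_countable (card_image_le _ _) _; exact: countableP.
exists (range (fun k : nat => k%:R)); split.
- exact: countable_measurable.
- exact: countable_lebesgue_measure0.
- move=> t /= h; apply: contrapT => ht; apply: h => k tk; apply: ht.
  by exists k.
Qed.

(** Rises from 0 to 1 on [[k, k + 1]] and is constant elsewhere. A path built as a sum of ramps is
    Lipschitz at once, with no gluing at the integer times. *)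
Definition ramp (R : realType) (k : nat) (t : R) := clamp 0 1 (t - k%:R).

(* The path with value [a] at time [0] and slope [c`_k] on [[k, k + 1]]. *)
Definition pl (R : realType) (a : R) (c : seq R) (t : R) :=
  a + \sum_(k < 6) c`_k * ramp k t.

Lemma pl_piece (R : realType) (a : R) c (k : nat) (t : R) : (k < 6)%N ->
  k%:R <= t <= k.+1%:R ->
  pl a c t = a + \sum_(j < k) c`_j + c`_k * (t - k%:R).
Proof.
move=> k6 /andP[kt tk]; rewrite /pl -addrA; congr (_ + _).
have rE (j : nat) : ramp j t = (j < k)%N%:R + (j == k)%:R * (t - k%:R).
  rewrite -addn1 natrD in tk.
  case: (ltngtP j k) => [jk|kj|->].
  - rewrite mul0r addr0 /ramp /clamp.
    have : j%:R + 1 <= k%:R :> R by rewrite -[1]/(1%:R) -natrD ler_nat addn1.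
    by move=> h; rewrite minEle ifT ?(max_idPr _)//; lra.
  - rewrite mul0r addr0 /ramp /clamp.
    have : k%:R + 1 <= j%:R :> R by rewrite -[1]/(1%:R) -natrD ler_nat addn1.
    by move=> h; apply/max_idPl; rewrite ge_min; apply/orP; right; lra.
  - rewrite mul1r add0r /ramp clamp_id//; apply/andP; split; lra.
under eq_bigr do rewrite rE mulrDr.
rewrite big_split/=; congr (_ + _).
  rewrite (big_ord_widen 6 (fun j => c`_j) (ltnW k6)) [RHS]big_mkcond/=.
  by apply: eq_bigr => j _; case: ifP; rewrite ?mulr1 ?mulr0.
rewrite (bigD1 (Ordinal k6))//= eqxx mul1r big1 ?addr0// => j.
by rewrite -val_eqE/= => /negPf ->; rewrite mul0r mulr0.
Qed.

Lemma pl_derive (R : realType) (a : R) c (k : nat) (t : R) : (k < 6)%N ->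
  k%:R < t < k.+1%:R -> derivable (pl a c) t 1 /\ derive1 (pl a c) t = c`_k.
Proof.
move=> k6 /andP[kt tk].
pose s0 := a + \sum_(j < k) c`_j - c`_k * k%:R.
pose g (s : R) := c`_k * s + 1 * cst s0 s.
have gE : \forall s \near t, g s = pl a c s.
  near=> s; rewrite (@pl_piece _ _ _ k)//; first by rewrite /g /s0 /cst/=; ring.
  apply/andP; split; apply/ltW; near: s; [exact: lt_nbhsr|exact: lt_nbhsl].
have [dg g'] := derive1_lin c`_k 1 (@derivable_id _ _ t 1) (@derivable_cst _ _ _ s0 t 1).
split; first exact: near_eq_derivable gE dg.
rewrite derive1E -(near_eq_derive _ gE) -derive1E g'.
by rewrite derive1_id derive1_cst mulr1 mulr0 addr0.
Unshelve. all: by end_near. Qed.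

Lemma pl_abs_cont (R : realType) (a : R) c (x y : R) : abs_cont x y (pl a c).
Proof.
apply: (@lipschitz_abs_cont _ _ _ (\sum_(k < 6) `|c`_k|)) => s t _ st _.
rewrite /pl opprD addrACA subrr add0r -sumrB mulr_suml.
apply: le_trans (ler_norm_sum _ _ _) _; apply: ler_sum => k _.
rewrite -mulrBr normrM ler_wpM2l//.
apply: le_trans (clamp_dist _ _ ler01) _.
by rewrite opprB addrA subrK ger0_norm// subr_ge0.
Qed.

Definition vpl (R : realType) (a : R * R) (m : seq (R * R)) (t : R) : R * R :=
  (pl a.1 (map fst m) t, pl a.2 (map snd m) t).

Lemma vpl_derive (R : realType) (a : R * R) m (k : nat) (t : R) : (k < 6)%N ->
  k%:R < t < k.+1%:R -> derivable2 (vpl a m) t /\ dvec (vpl a m) t = nth (0, 0) m k.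
Proof.
move=> k6 kt.
have [d1 e1] := pl_derive a.1 (map fst m) k6 kt.
have [d2 e2] := pl_derive a.2 (map snd m) k6 kt.
split; first by split.
rewrite /dvec /vpl/= e1 e2.
have [km|mk] := ltnP k (size m).
  by rewrite !(nth_map (0, 0))//; case: (nth _ _ _).
by rewrite !nth_default ?size_map.
Qed.

Lemma piece_of (R : realType) (t : R) : 0 <= t <= 6 ->
  exists k, (k < 6)%N /\ k%:R <= t <= k.+1%:R.
Proof.
move=> /andP[t0 t6].
case: (leP t 1) => h1; first by exists 0%N; rewrite t0 h1.
case: (leP t 2) => h2; first by exists 1%N; rewrite (ltW h1) h2.
case: (leP t 3) => h3; first by exists 2%N; rewrite (ltW h2) h3.
case: (leP t 4) => h4; first by exists 3%N; rewrite (ltW h3) h4.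
case: (leP t 5) => h5; first by exists 4%N; rewrite (ltW h4) h5.
by exists 5%N; rewrite (ltW h5) t6.
Qed.

Lemma normal_cone_interior (R : realType) (A : set (R * R)) z n : compact A ->
  interior A z -> normal_cone A z n -> n = (0, 0).
Proof.
move=> cA Az An; apply: contrapT => /(dot_interior_lt cA Az).
have [|y [Ay ->]] := hQ_att n cA; first by exists z; exact: interior_subset.
by have := An y Ay; rewrite /dot /vsub/=; lra.
Qed.

Lemma vsub_eq0 (R : realType) (u v : R * R) : vsub u v = (0, 0) -> u = v.
Proof.
by case: u v => [u1 u2] [v1 v2] [/eqP + /eqP]; rewrite !subr_eq0/= => /eqP -> /eqP ->.
Qed.

Lemma pair_split (A B : Type) (a a' : A) (b b' : B) :
  (a, b) = (a', b') -> a = a' /\ b = b'.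
Proof. by move=> [-> ->]. Qed.

(** * The closed trajectory with three positions and three momenta *)

Section billiard_path.
Variables (R : realType) (K Q : set (R * R)).
Hypotheses (cK : compact K) (cQ : compact Q).
Hypotheses (cvK : Defs.convex_set K) (cvQ : Defs.convex_set Q).

(* At an interior momentum the adjacent position edge is degenerate, and at an
   interior position the adjacent momentum edges are, so all edges are. *)
Lemma no_interior_contact (q1 q2 q3 p1 p2 p3 : R * R) :
  normal_cone Q p1 (vsub q2 q1) -> normal_cone Q p2 (vsub q3 q2) ->
  normal_cone Q p3 (vsub q1 q3) ->
  normal_cone K q1 (vsub p3 p1) -> normal_cone K q2 (vsub p1 p2) ->
  normal_cone K q3 (vsub p2 p3) ->
  ~ (q1 = q2 /\ q2 = q3) -> interior Q p1 -> interior K q1 \/ interior K q2 ->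
  False.
Proof.
move=> n1 n2 n3 m1 m2 m3 nd Q1 Kq; apply: nd.
have e12 : q2 = q1 by apply/vsub_eq0/(normal_cone_interior cQ Q1 n1).
rewrite e12 in m2 n2 Kq *; have {}Kq : interior K q1 by case: Kq.
have e31 := vsub_eq0 (normal_cone_interior cK Kq m1).
have e12' := vsub_eq0 (normal_cone_interior cK Kq m2).
rewrite e31 in n3; rewrite -e12' in n2.
by have -> := vsub_eq0 (normal_cone_interior cQ Q1 n3).
Qed.

(** One leg of the trajectory: a point moves from [u] to [v] in [A] while [w] in [B] rests. If [w]
    is interior, the leg is degenerate and the moving point stays at [u], which by hypothesis is
    then not interior. It serves with [K] and [Q] in either role. *)
Lemma contact_piece (A B : set (R * R)) (u v w : R * R) (t : R) :
  compact B -> Defs.convex_set A -> A u -> A v -> B w ->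
  normal_cone B w (vsub v u) \/ normal_cone B w (vsub u v) ->
  ~ (interior B w /\ interior A u) -> 0 <= t <= 1 ->
  A (vadd u (vscale t (vsub v u))) /\ B w /\
  (~ interior A (vadd u (vscale t (vsub v u))) \/ ~ interior B w).
Proof.
move=> cB cvA Au Av Bw n nint t01.
have E : vadd u (vscale t (vsub v u)) = vadd (vscale t v) (vscale (1 - t) u).
  by rewrite /vadd /vscale /vsub/=; congr pair; ring.
split; first by rewrite E; exact: cvA.
split=> //; have [Bi|] := pselect (interior B w); last by right.
left=> Ai; apply: nint; split=> //.
have uv : v = u.
  by case: n => /(normal_cone_interior cB Bi)/vsub_eq0.
by move: Ai; rewrite E uv /vadd /vscale/= -!mulrDl subrKC !mul1r; case: (u).
Qed.

Variables q1 q2 q3 p1 p2 p3 : R * R.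
Hypotheses (K1 : K q1) (K2 : K q2) (K3 : K q3) (Q1 : Q p1) (Q2 : Q p2) (Q3 : Q p3).
Hypotheses (nQ1 : normal_cone Q p1 (vsub q2 q1))
  (nQ2 : normal_cone Q p2 (vsub q3 q2)) (nQ3 : normal_cone Q p3 (vsub q1 q3))
  (nK1 : normal_cone K q1 (vsub p3 p1)) (nK2 : normal_cone K q2 (vsub p1 p2))
  (nK3 : normal_cone K q3 (vsub p2 p3)).
Let c := dot p1 (vsub q2 q1) + dot p2 (vsub q3 q2) + dot p3 (vsub q1 q3).
Hypothesis c0 : 0 < c.
Let o : R * R := (0, 0).

(** Position and momentum move in turn, which takes six unit intervals; [o] marks the one at rest.
    The momentum is [p1] from [q1] to [q2], and turns from [p1] to [p2] at [q2]. *)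
Let qs := [:: vsub q2 q1; o; vsub q3 q2; o; vsub q1 q3; o].
Let ps := [:: o; vsub p2 p1; o; vsub p3 p2; o; vsub p1 p3].
Let q := vpl q1 qs.
Let p := vpl p1 ps.

Let not_all_eq : ~ (q1 = q2 /\ q2 = q3).
Proof.
move=> [e12 e23]; move: c0.
by rewrite /c /dot /vsub/= -e23 -e12 !subrr !mulr0 !addr0 ltxx.
Qed.

Let path_piece k t : (k < 6)%N -> k%:R <= t <= k.+1%:R ->
  (q t, p t) = nth (o, o) [::
    (vadd q1 (vscale (t - k%:R) (vsub q2 q1)), p1);
    (q2, vadd p1 (vscale (t - k%:R) (vsub p2 p1)));
    (vadd q2 (vscale (t - k%:R) (vsub q3 q2)), p2);
    (q3, vadd p2 (vscale (t - k%:R) (vsub p3 p2)));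
    (vadd q3 (vscale (t - k%:R) (vsub q1 q3)), p3);
    (q1, vadd p3 (vscale (t - k%:R) (vsub p1 p3)))] k.
Proof.
move=> k6 kt; rewrite /q /p /vpl !(pl_piece _ _ k6 kt).
case: k k6 kt => [|[|[|[|[|[|k]]]]]] // _ _;
  rewrite ?(big_ord_recr, big_ord0)/= /vadd /vscale /vsub /o/=;
  case: (q1) (q2) (q3) (p1) (p2) (p3) => [? ?] [? ?] [? ?] [? ?] [? ?] [? ?] /=;
  by congr (pair _ _); congr pair; ring.
Qed.

Let path_boundary t : 0 <= t <= 6 ->
  K (q t) /\ Q (p t) /\ (~ interior K (q t) \/ ~ interior Q (p t)).
Proof.
have ni1 := no_interior_contact nQ1 nQ2 nQ3 nK1 nK2 nK3 not_all_eq.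
have ni2 : interior Q p2 -> interior K q2 \/ interior K q3 -> False.
  apply: (no_interior_contact nQ2 nQ3 nQ1 nK2 nK3 nK1).
  by move=> [h1 h2]; apply: not_all_eq; rewrite h1 h2.
have ni3 : interior Q p3 -> interior K q3 \/ interior K q1 -> False.
  apply: (no_interior_contact nQ3 nQ1 nQ2 nK3 nK1 nK2).
  by move=> [h1 h2]; apply: not_all_eq; rewrite -h2 h1.
have sw A B : A /\ B /\ (~ interior Q (p t) \/ ~ interior K (q t)) ->
  B /\ A /\ (~ interior K (q t) \/ ~ interior Q (p t)) by tauto.
move=> /piece_of[k [k6 kt]].
have t01 : 0 <= t - k%:R <= 1.
  by move: kt => /andP[h1]; rewrite -addn1 natrD => h2; apply/andP; split; lra.
have := path_piece k6 kt.
case: k k6 kt t01 => [|[|[|[|[|[|k]]]]]] // _ _ t01 /= e;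
  have [hq hp] := pair_split e; rewrite hq hp {e}.
- by apply: contact_piece => //; [left|move=> [h ?]; apply: ni1 => //; left].
- rewrite -hq -hp; apply: sw; rewrite hq hp.
  by apply: contact_piece => //; [right|move=> [? h]; apply: ni1 => //; right].
- by apply: contact_piece => //; [left|move=> [h ?]; apply: ni2 => //; left].
- rewrite -hq -hp; apply: sw; rewrite hq hp.
  by apply: contact_piece => //; [right|move=> [? h]; apply: ni2 => //; right].
- by apply: contact_piece => //; [left|move=> [h ?]; apply: ni3 => //; left].
- rewrite -hq -hp; apply: sw; rewrite hq hp.
  by apply: contact_piece => //; [right|move=> [? h]; apply: ni3 => //; right].
Qed.

Let ae_piece : {ae (@lebesgue_measure R), forall t, 0 <= t <= 6 ->
  exists k, (k < 6)%N /\ k%:R < t < k.+1%:R}.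
Proof.
apply: ae_lebesgue_imply (ae_not_nat R) => t tn /piece_of[k [k6 /andP[h1 h2]]].
exists k; split=> //; rewrite !lt_neqAle h1 h2 !andbT.
by apply/andP; split; apply/eqP => // /esym; exact: tn.
Qed.

Let at_int (k : nat) : (k < 6)%N -> ((k%:R : R) <= (k%:R : R)) && ((k%:R : R) <= k.+1%:R).
Proof. by move=> _; rewrite lexx ler_nat leqnSn. Qed.

Let path_start : (q 0, p 0) = (q1, p1).
Proof.
rewrite (@path_piece 0%N 0)//; last by rewrite lexx ler01.
by rewrite /= subrr /vadd /vscale/= !mul0r !addr0; case: (q1).
Qed.

Let path_end : (q 6, p 6) = (q1, p1).
Proof.
rewrite (@path_piece 5%N 6)//; last by rewrite lexx ler_nat.
have -> : 6 - 5%:R = 1 :> R by ring.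
by rewrite /= /vadd /vscale /vsub/=; congr pair; case: (p1) => x y /=; congr pair; ring.
Qed.

Lemma path_gen_char : gen_char K Q 6 q p.
Proof.
split; first by [].
do 4!(split; first exact: pl_abs_cont).
have [qs0 ps0] := pair_split path_start; have [qe pe] := pair_split path_end.
split; first by rewrite qs0 qe.
split; first by rewrite ps0 pe.
split; first exact: path_boundary.
split.
  (* The path is at [q2] at time 1 and at [q3] at time 4, and one of these differs from [q1]. *)
  have [e12|n12] := pselect (q2 = q1).
    exists 4; split; first by rewrite ler0n ler_nat.
    left; have [-> _] := pair_split (@path_piece 4%N 4 isT (@at_int 4%N isT)).
    rewrite subrr qs0 /vadd /vscale/= !mul0r !addr0 => h.
    by apply: not_all_eq; rewrite e12; split=> //; rewrite -h; case: (q3).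
  exists 1; split; first by rewrite ler01 ler1n.
  by left; have [-> _] := pair_split (@path_piece 1%N 1 isT (@at_int 1%N isT)); rewrite qs0.
apply: ae_lebesgue_imply ae_piece => t h /h[k [k6 kt]].
have [dq eq] := vpl_derive q1 qs k6 kt; have [dp ep] := vpl_derive p1 ps k6 kt.
split=> //; split=> //; rewrite eq ep.
have kt' : k%:R <= t <= k.+1%:R by move: kt => /andP[? ?]; rewrite !ltW.
have zK z : normal_cone K z o by move=> z' _; rewrite /dot /o/= !mul0r addr0.
have zQ z : normal_cone Q z o by move=> z' _; rewrite /dot /o/= !mul0r addr0.
have o0 : o = (- o.1, - o.2) by rewrite /o/= oppr0.
have sb (u v : R * R) : vsub v u = (- (vsub u v).1, - (vsub u v).2).
  by rewrite /vsub/= !opprB.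
have := path_piece k6 kt'.
case: k k6 kt kt' eq ep => [|[|[|[|[|[|k]]]]]] // _ _ _ _ _ /= e;
  have [hq hp] := pair_split e; rewrite hq hp {e}.
- by exists o, (vsub q2 q1).
- by exists (vsub p1 p2), o.
- by exists o, (vsub q3 q2).
- by exists (vsub p2 p3), o.
- by exists o, (vsub q1 q3).
- by exists (vsub p3 p1), o.
Qed.

(** The integrand is constant on each leg, with the values [cs]. Summation by parts shows that the
    momentum legs contribute as much as the position legs, so the factor 1/2 leaves [c]. *)
Lemma path_action : action 6 q p = c%:E.
Proof.
pose cs := [:: dot p1 (vsub q2 q1); - dot q2 (vsub p2 p1); dot p2 (vsub q3 q2);
  - dot q3 (vsub p3 p2); dot p3 (vsub q1 q3); - dot q1 (vsub p1 p3)].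
rewrite /action (@ae_integral_derive1 _ 0 6 (pl 0 cs)) //; last 2 first.
- exact: pl_abs_cont.
- apply: ae_lebesgue_imply ae_piece => t h /h[k [k6 kt]].
  have [d e] := pl_derive 0 cs k6 kt; split=> //; rewrite e.
  have [dq eq] := vpl_derive q1 qs k6 kt; have [dp ep] := vpl_derive p1 ps k6 kt.
  rewrite eq ep.
  have kt' : k%:R <= t <= k.+1%:R by move: kt => /andP[? ?]; rewrite !ltW.
  have := path_piece k6 kt'.
  case: k k6 kt kt' e eq ep => [|[|[|[|[|[|k]]]]]] // _ _ _ _ _ _ /= h';
    have [hq hp] := pair_split h';
    rewrite hq hp /= /dot /o/=; ring.
rewrite -EFinM; congr EFin.
rewrite (@pl_piece _ 0 cs 5%N 6)//; last by rewrite lexx ler_nat.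
rewrite (@pl_piece _ 0 cs 0%N 0)//; last by rewrite lexx ler01.
have -> : 6 - 5%:R = 1 :> R by ring.
by rewrite !big_ord_recr !big_ord0/= /c /dot /vsub/=; field.
Qed.
End billiard_path.

(** * A triangle that does not fit bounds the capacity *)

Lemma compact_triples (R : realType) (A : set (R * R))
    (f : (R * R) * (R * R) * (R * R) -> (R * R) * (R * R)) : compact A ->
  continuous f -> compact (f @` ((A `*` A) `*` A)).
Proof.
move=> cA cf; apply: continuous_compact; first exact: continuous_subspaceT.
by do !apply: compact_setX.
Qed.

Lemma short_triangle_capacity (R : realType) (K Q : set (R * R)) (u v w : R * R) :
  convex_shape K -> compact Q -> Defs.convex_set Q -> interior Q !=set0 ->
  hQ Q (vsub v u) + hQ Q (vsub w v) + hQ Q (vsub u w) = 1 ->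
  ~ (exists t, [/\ K (vadd u t), K (vadd v t) & K (vadd w t)]) ->
  (capacity K Q < 1%:E)%E.
Proof.
move=> [cK [cvK [k0 Kk0]]] cQ cvQ [y0 Qy0] len1 nofit.
have [r [r0 hr]] := interior_box Kk0; have [r' [r'0 hr']] := interior_box Qy0.
have {}Kk0 := interior_subset Kk0; have {}Qy0 := interior_subset Qy0.
(* Dual coordinates modulo translations: edges issuing from the first position, and differences of
   successive momenta. With these choices [dot4] is the sum of <q_(i+1) - q_i, p_i>, by [dotE], and
   [dotE'] is the same sum arranged by positions. *)
pose fA (q : (R * R) * (R * R) * (R * R)) := (vsub q.1.2 q.1.1, vsub q.2 q.1.1).
pose fB (p : (R * R) * (R * R) * (R * R)) := (vsub p.1.1 p.1.2, vsub p.1.2 p.2).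
pose A := fA @` ((K `*` K) `*` K); pose B := fB @` ((Q `*` Q) `*` Q).
have cA : compact A.
  apply: compact_triples => // x; have hid : y @[y --> x] --> x by exact: cvg_id.
  have h1 := cvg_fst_comp hid; have h2 := cvg_snd_comp hid.
  exact: cvg_pair (cvg_vsub (cvg_snd_comp h1) (cvg_fst_comp h1))
    (cvg_vsub h2 (cvg_fst_comp h1)).
have cB : compact B.
  apply: compact_triples => // x; have hid : y @[y --> x] --> x by exact: cvg_id.
  have h1 := cvg_fst_comp hid; have h2 := cvg_snd_comp hid.
  exact: cvg_pair (cvg_vsub (cvg_fst_comp h1) (cvg_snd_comp h1))
    (cvg_vsub (cvg_snd_comp h1) h2).
have vA : convex4 A.
  move=> _ _ [[[x1 x2] x3] [[/= X1 X2] X3] <-] [[[y1 y2] y3] [[/= Y1 Y2] Y3] <-] t t01.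
  exists (vadd (vscale t x1) (vscale (1 - t) y1), vadd (vscale t x2) (vscale (1 - t) y2),
    vadd (vscale t x3) (vscale (1 - t) y3)).
    by do !split; apply: cvK.
  by rewrite /fA /vadd /vscale /vsub/=; congr pair; congr pair; ring.
have vB : convex4 B.
  move=> _ _ [[[x1 x2] x3] [[/= X1 X2] X3] <-] [[[y1 y2] y3] [[/= Y1 Y2] Y3] <-] t t01.
  exists (vadd (vscale t x1) (vscale (1 - t) y1), vadd (vscale t x2) (vscale (1 - t) y2),
    vadd (vscale t x3) (vscale (1 - t) y3)).
    by do !split; apply: cvQ.
  by rewrite /fB /vadd /vscale /vsub/=; congr pair; congr pair; ring.
have A0 : A ((0, 0), (0, 0)).
  by exists (k0, k0, k0) => //=; rewrite /fA /vsub/= !subrr.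
have B0 : B ((0, 0), (0, 0)).
  by exists (y0, y0, y0) => //=; rewrite /fB /vsub/= !subrr.
have pA : compact (polar A).
  (* Moving a single vertex within a box in [K] already fills a box in each factor. *)
  apply: (polar_compact r0) => a b ha hb; have Kab := hr a b ha hb; split.
    exists (k0, (k0.1 + a, k0.2 + b), k0) => //.
    by rewrite /fA /vsub/=; congr pair; congr pair; ring.
  exists (k0, k0, (k0.1 + a, k0.2 + b)) => //.
  by rewrite /fA /vsub/=; congr pair; congr pair; ring.
have pB : compact (polar B).
  apply: (polar_compact r'0) => a b ha hb; split.
    exists ((y0.1 + a, y0.2 + b), y0, y0); first by do !split => //; exact: hr'.
    by rewrite /fB /vsub/=; congr pair; congr pair; ring.
  (* The third momentum enters [fB] with a minus sign. *)
  exists (y0, y0, (y0.1 + - a, y0.2 + - b)).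
    by do !split => //; apply: hr'; rewrite normrN.
  by rewrite /fB /vsub/=; congr pair; congr pair; ring.
have dotE (q1 q2 q3 p1 p2 p3 : R * R) :
    dot4 (vsub q2 q1, vsub q3 q1) (vsub p1 p2, vsub p2 p3) =
    dot (vsub q2 q1) p1 + dot (vsub q3 q2) p2 + dot (vsub q1 q3) p3.
  by rewrite /dot4 /dot /vsub/=; ring.
have dotE' (q1 q2 q3 p1 p2 p3 : R * R) :
    dot4 (vsub q2 q1, vsub q3 q1) (vsub p1 p2, vsub p2 p3) =
    dot (vsub p3 p1) q1 + dot (vsub p1 p2) q2 + dot (vsub p2 p3) q3.
  by rewrite /dot4 /dot /vsub/=; ring.
have [||a [b [[[[q1 q2] q3] [[/= K1 K2] K3] <-] [[[p1 p2] p3] [[/= Q1 Q2] Q3] <-]]]] :=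
  @polar_critical_pair _ A B (vsub v u, vsub w u) cA vA A0 pA cB vB B0 pB.
(* Each edge pairs with a momentum in [Q] to at most its length, so unit length means membership in
   [polar B]. *)
- move=> _ [[[p1 p2] p3] [[/= Q1 Q2] Q3] <-]; rewrite /fB/= dotE -len1.
  by rewrite !lerD// hQ_ub.
- move=> [[[q1 q2] q3] [[/= K1 K2] K3] [e1 e2 e3 e4]]; apply: nofit.
  exists (vsub q1 u); split.
  + suff -> : vadd u (vsub q1 u) = q1 by [].
    by case: (q1) => x y; rewrite /vadd /vsub/=; congr pair; ring.
  + suff -> : vadd v (vsub q1 u) = q2 by [].
    by case: (q2) e1 e2 => x y /= e1 e2; rewrite /vadd /vsub/=; congr pair; lra.
  + suff -> : vadd w (vsub q1 u) = q3 by [].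
    by case: (q3) e3 e4 => x y /= e3 e4; rewrite /vadd /vsub/=; congr pair; lra.
rewrite /fA /fB/= => c0 c1 [hB hA].
(* Optimality over triples of momenta; changing one momentum at a time gives the three normal cone
   conditions in [Q]. [optA] does the same for positions. *)
have optB p1' p2' p3' : Q p1' -> Q p2' -> Q p3' ->
    dot (vsub q2 q1) p1' + dot (vsub q3 q2) p2' + dot (vsub q1 q3) p3' <=
    dot (vsub q2 q1) p1 + dot (vsub q3 q2) p2 + dot (vsub q1 q3) p3.
  move=> h1 h2 h3; have := hB (vsub p1' p2', vsub p2' p3'); rewrite !dotE; apply.
  by exists (p1', p2', p3').
have optA q1' q2' q3' : K q1' -> K q2' -> K q3' ->
    dot (vsub p3 p1) q1' + dot (vsub p1 p2) q2' + dot (vsub p2 p3) q3' <=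
    dot (vsub p3 p1) q1 + dot (vsub p1 p2) q2 + dot (vsub p2 p3) q3.
  move=> h1 h2 h3; have := hA (vsub q2' q1', vsub q3' q1'); rewrite !dotE'; apply.
  by exists (q1', q2', q3').
have sub (n z z' : R * R) : dot n (vsub z' z) = dot n z' - dot n z.
  by rewrite /dot /vsub/=; ring.
have n1 : normal_cone Q p1 (vsub q2 q1).
  by move=> z Qz; have := optB z p2 p3 Qz Q2 Q3; rewrite sub; lra.
have n2 : normal_cone Q p2 (vsub q3 q2).
  by move=> z Qz; have := optB p1 z p3 Q1 Qz Q3; rewrite sub; lra.
have n3 : normal_cone Q p3 (vsub q1 q3).
  by move=> z Qz; have := optB p1 p2 z Q1 Q2 Qz; rewrite sub; lra.
have m1 : normal_cone K q1 (vsub p3 p1).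
  by move=> z Kz; have := optA z q2 q3 Kz K2 K3; rewrite sub; lra.
have m2 : normal_cone K q2 (vsub p1 p2).
  by move=> z Kz; have := optA q1 z q3 K1 Kz K3; rewrite sub; lra.
have m3 : normal_cone K q3 (vsub p2 p3).
  by move=> z Kz; have := optA q1 q2 z K1 K2 Kz; rewrite sub; lra.
have cE : dot4 (vsub q2 q1, vsub q3 q1) (vsub p1 p2, vsub p2 p3) =
    dot p1 (vsub q2 q1) + dot p2 (vsub q3 q2) + dot p3 (vsub q1 q3).
  by rewrite dotE /dot; ring.
rewrite cE in c0 c1.
have gc := path_gen_char cK cQ cvK cvQ K1 K2 K3 Q1 Q2 Q3 n1 n2 n3 m1 m2 m3 c0.
apply: (@le_lt_trans _ _ (dot p1 (vsub q2 q1) + dot p2 (vsub q3 q2) +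
  dot p3 (vsub q1 q3))%:E); last by rewrite lte_fin.
apply: ereal_inf_lbound; exists 6; do 2!eexists; split; first exact: gc.
by rewrite path_action.
Qed.

Lemma Qnormal_fits (R : realType) (K Q T : set (R * R)) :
  convex_shape K -> compact Q -> Defs.convex_set Q -> interior Q !=set0 ->
  (1%:E <= capacity K Q)%E -> Qnormal_triangle Q T -> fits T K.
Proof.
move=> sK cQ cvQ Q0 cap.
have cvK : Defs.convex_set K by case: sK => _ [].
have fit3 u v w : hQ Q (vsub v u) + hQ Q (vsub w v) + hQ Q (vsub u w) = 1 ->
    exists t, [/\ K (vadd u t), K (vadd v t) & K (vadd w t)].
  move=> len1; apply: contrapT => nofit; move: cap; apply/negP; rewrite -ltNge.
  exact: short_triangle_capacity len1 nofit.
have comb t u v r : 0 <= r <= 1 -> K (vadd u t) -> K (vadd v t) ->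
    K (vadd (vadd (vscale r u) (vscale (1 - r) v)) t).
  move=> r01 Ku Kv; have := cvK _ _ Ku Kv r r01.
  by congr K; rewrite /vadd /vscale/=; congr pair; ring.
move=> [[u [v [w [_ [-> [_ [_ [_ len1]]]]]]]]|[u [v [-> [_ [_ len1]]]]]].
  have [t [Ku Kv Kw]] := fit3 u v w len1; exists t => _ [a [b [c [a0 [b0 [c0 [s1 ->]]]]]]].
  (* The point of the triangle is [u], or lies between [u] and a point of the side from [v] to
     [w]. *)
  have [b1|b1] := eqVneq (b + c) 0.
    have [-> ->] : b = 0 /\ c = 0 by split; lra.
    have -> : a = 1 by lra.
    have := Ku; congr K; rewrite /vadd /vscale/=; congr pair; ring.
  have bc : 0 < b + c by rewrite lt_neqAle eq_sym b1 addr_ge0.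
  have h := @comb t v w (b / (b + c)).
  have {}h : K (vadd (vadd (vscale (b / (b + c)) v) (vscale (1 - b / (b + c)) w)) t).
    by apply: h => //; rewrite divr_ge0 ?(ltW bc)//= ler_pdivrMr// mul1r lerDl.
  have := @comb t u _ a _ Ku h; rewrite a0/= => h2.
  have {}h2 : K _ := h2 ltac:(lra).
  move: h2; congr K; have aE : 1 - a = b + c by lra.
  by rewrite /vadd /vscale/= aE; congr pair; field.
(* A segment is a triangle with a repeated vertex, whose extra edge has length zero. *)
have [|t [Ku Kv _]] := fit3 u v v.
  have -> : vsub v v = (0, 0) by rewrite /vsub !subrr.
  by rewrite hQ0 ?addr0//; have [y /interior_subset] := Q0; exists y.
by exists t => _ [r [r01 ->]]; exact: comb.
Qed.

Theorem theorem3p3 (R : realType) (Q K : set (R * R)) :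
  convex_polygon Q -> convex_shape K ->
  ((forall T : set (R * R), Qnormal_triangle Q T -> fits T K) ->
     forall g : R -> R * R, closed_curve g -> Qlength Q g = 1%:E ->
       fits (curve_image g) K)
  /\
  ((forall T : set (R * R), Qnormal_triangle Q T -> fits T K) <->
     (1%:E <= capacity K Q)%E).
Proof.
move=> [[n [s ->]] Q0] sK; split=> [QK g|].
  exact: unit_curve_fits.
split=> [QK|cap T]; first exact: capacity_ge1.
by apply: Qnormal_fits => //; [exact: conv_hull_compact|exact: conv_hull_convex].
Qed.
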